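(* Let $n\geqslant 9$, $\alpha\in[0,1)$, and let $G$ be a graph having the minimum $A_\alpha$-index among all connected graphs of order $n$ with independence number $n-3$. Then $G\cong H_3(s,t,k)$ for some nonnegative integers $s,t,k$ with $|s-k|\leqslant 1$ and $s+t+k=n-5$. Furthermore: (i) if $\alpha\in[\frac12,1)$ and $n=3m$, then $G\cong H_3(m-1,m-3,m-1)$; (ii) if $\alpha\in[\frac12,1)$ and $n=3m+1$, then $G\cong H_3(m-1,m-2,m-1)$; (iii) if $\alpha\in[\frac{11}{20},1)$ and $n=3m+2$, then $G\cong H_3(m,m-3,m)$.
   Context: All graphs are finite, simple and connected. For a graph $G$ with adjacency matrix $A(G)$ and diagonal degree matrix $D(G)$, and $\alpha\in[0,1]$, $A_\alpha(G)=\alpha D(G)+(1-\alpha)A(G)$; the $A_\alpha$-index $\lambda_\alpha(G)$ is its largest eigenvalue. The independence number is the maximum size of a set of pairwise non-adjacent vertices. For nonnegative integers $s,t,k$ with $\max\{s,t,k\}\geqslant1$ and $s+t+k=n-5$, $H_3(s,t,k)$ is the $n$-vertex tree obtained from the path $v_1v_4v_2v_5v_3$ by attaching $s$ pendant edges at $v_1$, $t$ pendant edges at $v_2$, and $k$ pendant edges at $v_3$. *)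

(* Defs.v *)
From HB Require Import structures.
From mathcomp Require Import all_boot all_order all_algebra.
From mathcomp Require Import reals.

Set Implicit Arguments.
Unset Strict Implicit.
Unset Printing Implicit Defensive.

Import Order.TTheory GRing.Theory Num.Theory.
Local Open Scope ring_scope.

Record sgraph := SGraph {
  vertex :> finType;
  adj : rel vertex;
  adj_sym : symmetric adj;
  adj_irrefl : irreflexive adj }.

Definition connected_graph (G : sgraph) : Prop :=
  forall x y : G, connect (@adj G) x y.

Definition isomorphic (G H : sgraph) : Prop :=
  exists2 f : G -> H, bijective f & forall x y : G, adj (f x) (f y) = adj x y.

Definition independent (G : sgraph) (S : {set G}) : bool :=
  [forall x in S, forall y in S, ~~ adj x y].

Definition independence_number (G : sgraph) : nat :=
  \max_(S : {set G} | independent S) #|S|.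

Definition degree (G : sgraph) (x : G) : nat := #|[set y : G | adj x y]|.

(* Rows and columns of these matrices are indexed by the vertices of [G] in
   the order of [enum G]; another order gives a similar matrix. *)
Definition adjacency_mx (R : realType) (G : sgraph) : 'M[R]_#|G| :=
  \matrix_(i, j) (adj (enum_val i) (enum_val j))%:R.

Definition degree_mx (R : realType) (G : sgraph) : 'M[R]_#|G| :=
  diag_mx (\row_i (degree (enum_val i))%:R).

Definition Aalpha_mx (R : realType) (alpha : R) (G : sgraph) : 'M[R]_#|G| :=
  alpha *: degree_mx R G + (1 - alpha) *: adjacency_mx R G.

Definition largest_eigenvalue (R : realType) (n : nat) (A : 'M[R]_n) (l : R) :
    Prop :=
  eigenvalue A l /\ forall mu : R, eigenvalue A mu -> mu <= l.

(* [Aalpha_index alpha G l] reads "lambda_alpha(G) = l": the largest eigenvalue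
   is unique, and it exists because the matrix is real symmetric (for nonempty
   [G]). *)
Definition Aalpha_index (R : realType) (alpha : R) (G : sgraph) (l : R) : Prop :=
  largest_eigenvalue (Aalpha_mx alpha G) l.

Definition in_class (n a : nat) (G : sgraph) : Prop :=
  [/\ connected_graph G, #|G| = n & independence_number G = a].

Definition min_Aalpha_index (R : realType) (alpha : R) (n a : nat)
    (G : sgraph) : Prop :=
  in_class n a G /\
  exists2 l : R, Aalpha_index alpha G l &
    forall (H : sgraph) (mu : R),
      in_class n a H -> Aalpha_index alpha H mu -> l <= mu.

Section H3.
Local Open Scope nat_scope.
Variables s t k : nat.

(* The summand ['I_5] is the path v1 v4 v2 v5 v3, its elements 0, 1, 2, 3, 4
   being v1, v4, v2, v5, v3 in this order; ['I_s], ['I_t] and ['I_k] are the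
   pendant vertices attached at v1, v2 and v3. *)
Definition H3_vertex : finType := ('I_5 + ('I_s + 'I_t + 'I_k))%type.

Definition H3_arc (x y : H3_vertex) : bool :=
  match x, y with
  | inl i, inl j => j == i.+1 :> nat
  | inl i, inr (inl (inl _)) => i == 0 :> nat
  | inl i, inr (inl (inr _)) => i == 2 :> nat
  | inl i, inr (inr _) => i == 4 :> nat
  | _, _ => false
  end.

Definition H3_adj : rel H3_vertex := fun x y => H3_arc x y || H3_arc y x.

Lemma H3_adj_sym : symmetric H3_adj.
Proof. by move=> x y; rewrite /H3_adj orbC. Qed.

Lemma H3_adj_irrefl : irreflexive H3_adj.
Proof. by case=> [i|[[i|i]|i]] //; rewrite /H3_adj /= orbb ltn_eqF. Qed.

Definition H3 : sgraph := SGraph H3_adj_sym H3_adj_irrefl.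

End H3.

(* Main.v *)
Require Import Defs.
From HB Require Import structures.
From mathcomp Require Import all_boot all_order all_algebra.
From mathcomp Require Import reals.
From mathcomp Require classical_sets topology normedtype derive.
From mathcomp Require Import ring lra zify.

Set Implicit Arguments.
Unset Strict Implicit.
Unset Printing Implicit Defensive.

Import Order.TTheory GRing.Theory Num.Theory.
Local Open Scope ring_scope.

(* Let S be an independent set of size n - 3 and x the Perron eigenvector of a
   minimal graph G, with eigenvalue l.  Each of the three vertices outside S has
   a neighbour in S, and by connectedness G has a spanning tree of one of four
   types: H3(s,t,k), the same with v4 or both of v4, v5 replaced by an edge, or
   pendant edges at three vertices with a common neighbour.  Restricted to such
   a tree, x satisfies A x <= l x; eliminating the tree vertices one after the
   other from the leaves turns this into one inequality at a root, in which the
   subtree hanging from a child with load v weighs a + b^2/(l - a - v), where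
   a = alpha and b = 1 - alpha.  For each tree other than an H3(s,t,k) with
   |s - k| <= 1 this inequality yields the strict one for some H3(s',t',k') of
   order n, and reading the elimination backwards gives y > 0 on H3(s',t',k')
   with A y <= l y and A y <> l y, so that H3(s',t',k') has index < l.  The same
   comparison with the three trees of the last claims settles those. *)

Lemma quadratic_of_cubic (R : realFieldType) (y d p c : R) :
    0 < p -> 0 <= d -> 0 < y - d -> 0 < c ->
    c * (y + y + p) <= y * (y - d) * (y + p) ->
  2 * c < y * (y + p) - d * y.
Proof.
move=> p0 d0 yd c0 H; rewrite ltNge; apply/negP => T.
have y0 : 0 < y by lra.
have T1 : (y - d) * (y * (y + p) - d * y) <= (y - d) * (2 * c).
  by rewrite ler_pM2l.
have T2 : d * (y * (y + p) - d * y) <= d * (2 * c) by rewrite ler_wpM2l.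
have := mulr_gt0 c0 p0; have := mulr_ge0 (mulr_ge0 d0 (ltW y0)) (ltW p0).
lra.
Qed.

Lemma quadratic_gt (R : realFieldType) (y d p c : R) :
  0 < p -> 0 <= c -> c + d * p <= p ^+ 2 -> p < y -> c < y * (y - d).
Proof.
move=> p0 c0 H py.
have dp : d <= p by rewrite -(ler_pM2r p0); lra.
have : 0 < (y - p) * (y + p - d) by apply: mulr_gt0; lra.
lra.
Qed.

Lemma quadratic_of_cubic2 (R : realFieldType) (y d p c : R) :
    0 < p -> 0 <= d -> 0 < y - p ->
    c * (y - p + y) <= (y - p) * (y - d) * y ->
  2 * c < (y - p) * (y + p - d).
Proof.
move=> p0 d0 py H.
have Y : 0 < y - p + y by lra.
rewrite -(ltr_pM2r Y).
have := mulr_gt0 (mulr_gt0 py p0) (ltr_wpDr d0 py).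
lra.
Qed.

(** * Eliminating branches *)

Section Branch.
Variables (R : realFieldType) (a b l : R).
Hypotheses (a_ge0 : 0 <= a) (b_gt0 : 0 < b).

(* With [l] the eigenvalue: a child whose own children contribute [v] times its
   entry contributes [branch v] times the entry of its parent; [pend] is the
   case of a leaf.  [endw], [midw] and [link] are the coefficients left on v1 (or
   v3), on v2, and between them once all other vertices of H3 are eliminated. *)
Definition branch (v : R) : R := a + b ^+ 2 / (l - a - v).
Definition pend : R := branch 0.
Definition link : R := b ^+ 2 / (l - a *+ 2).
Definition endw (s : nat) : R := l - a - link - s%:R * pend.
Definition midw (t : nat) : R := l - a *+ 2 - link *+ 2 - t%:R * pend.

(* The eliminated 3 x 3 system has a positive supersolution; [H3_sgood] is its
   strict version. *)
Definition H3_good (s t k : nat) : Prop :=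
  [/\ a *+ 2 < l, 0 < endw s, 0 < endw k &
      link ^+ 2 * (endw s + endw k) <= endw s * midw t * endw k].

Definition H3_sgood (s t k : nat) : Prop :=
  [/\ a *+ 2 < l, 0 < endw s, 0 < endw k &
      link ^+ 2 * (endw s + endw k) < endw s * midw t * endw k].

Let b2_gt0 : 0 < b ^+ 2. Proof. exact: exprn_gt0. Qed.

Lemma branch_le v w : v <= w -> w < l - a -> branch v <= branch w.
Proof.
move=> vw wl; rewrite /branch lerD2l ler_pM2l // lef_pV2 ?posrE; lra.
Qed.

Lemma branch_lt v w : v < w -> w < l - a -> branch v < branch w.
Proof.
move=> vw wl; rewrite /branch ltrD2l ltr_pM2l // ltf_pV2 ?posrE; lra.
Qed.

Lemma branch_gt v : v < l - a -> a < branch v.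
Proof. by move=> vl; rewrite /branch ltrDl divr_gt0 // subr_gt0. Qed.

Lemma branchE v : v < l - a -> (branch v - a) * (l - a - v) = b ^+ 2.
Proof. by move=> vl; rewrite /branch addrC addKr divfK ?subr_eq0 ?gt_eqF. Qed.

Lemma link_gt0 : a *+ 2 < l -> 0 < link.
Proof. by move=> al; rewrite /link divr_gt0 // subr_gt0. Qed.

Lemma pendE : 0 < l - a -> (pend - a) * (l - a) = b ^+ 2.
Proof. by move=> la; rewrite -(branchE la) subr0. Qed.

Lemma pend_gt : 0 < l - a -> a < pend.
Proof. exact: branch_gt. Qed.

Lemma linkE : a *+ 2 < l -> link * (l - a *+ 2) = b ^+ 2.
Proof. by move=> al; rewrite /link divfK // subr_eq0 gt_eqF. Qed.

Hypothesis a_lt_l : a < l.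
Let la_gt0 : 0 < l - a. Proof. by rewrite subr_gt0. Qed.
Let pend_gt0 : 0 < pend.
Proof. exact: le_lt_trans a_ge0 (pend_gt la_gt0). Qed.

Let basics : [/\ 0 <= a, 0 < l - a, 0 < pend & a < pend].
Proof. by split=> //; apply: pend_gt. Qed.

Lemma pend_ler s t : (s <= t)%N -> s%:R * pend <= t%:R * pend.
Proof. by move=> st; rewrite ler_pM2r // ler_nat. Qed.

(* Applying [branch] once more compares a child with [s.+1] leaves to the same
   child with one leaf less and its edge subdivided; for [s = 0] the two trees
   coincide. *)
Lemma branch_subdivide s : s.+1%:R * pend < l - a ->
  branch (s%:R * pend) <= s.+1%:R * pend ?= iff (s == 0%N).
Proof.
have [a0 la0 p0 ap] := basics.
move=> sl; have sl' : s%:R * pend < l - a.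
  by apply: le_lt_trans sl; apply: pend_ler.
have E := branchE sl'; have E' := pendE la_gt0.
have S0 : 0 <= s%:R :> R by [].
have S1 : s.+1%:R = s%:R + 1 :> R by rewrite natr1.
split; last first.
  case: s sl sl' E S0 S1 => [|s] sl sl' E S0 S1.
    by rewrite mul0r mul1r !eqxx.
  apply/negbTE; rewrite lt_eqF //.
  have S2 : 0 < s.+1%:R :> R by rewrite ltr0n.
  rewrite S1 in sl *; move: (s.+1%:R : R) S2 sl sl' E {S0 S1} => r S2 sl sl' E.
  suff : (branch (r * pend) - a) * (l - a - r * pend) <
     ((r + 1) * pend - a) * (l - a - r * pend).
    by rewrite ltr_pM2r ?subr_gt0 // ltrD2r.
  have D : 0 < l - (r + 1) * pend by lra.
  have := mulr_gt0 (mulr_gt0 S2 pend_gt0) D.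
  rewrite E -E'; lra.
rewrite S1 in sl *.
suff : (branch (s%:R * pend) - a) * (l - a - s%:R * pend) <=
     ((s%:R + 1) * pend - a) * (l - a - s%:R * pend).
  by rewrite ler_pM2r ?subr_gt0 // lerD2r.
have D : 0 <= l - (s%:R + 1) * pend by lra.
have := mulr_ge0 (mulr_ge0 S0 (ltW pend_gt0)) D.
rewrite E -E'; lra.
Qed.

Lemma branch_branch s : s%:R * pend < l - a -> branch (s%:R * pend) < l - a ->
  [/\ a *+ 2 < l, 0 < endw s &
      branch (branch (s%:R * pend)) = a + link + link ^+ 2 / endw s].
Proof.
have [a0 la0 p0 ap] := basics.
move=> sl hl; have ah := branch_gt sl; have E := branchE sl.
have al : a *+ 2 < l by rewrite mulr2n; lra.
have lE := linkE al.
have X0 : 0 < endw s.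
  rewrite /endw; set A := l - a - s%:R * pend in E *.
  have A0 : 0 < A by rewrite subr_gt0.
  have : link * (l - a *+ 2) < A * (l - a *+ 2).
    by rewrite lE -E mulrC ltr_pM2l // mulr2n; lra.
  rewrite ltr_pM2r ?subr_gt0 // /A; lra.
split=> //.
have D0 : l - a - branch (s%:R * pend) != 0 by rewrite gt_eqF // subr_gt0.
have Y0 : l - a - s%:R * pend != 0 by rewrite gt_eqF // subr_gt0.
have Z0 : endw s != 0 by rewrite gt_eqF.
have W0 : l - a *+ 2 != 0 by rewrite subr_eq0 gt_eqF.
have BE : branch (s%:R * pend) = a + b ^+ 2 / (l - a - s%:R * pend) by [].
move: D0 Z0; rewrite [in RHS]/endw /endw /link BE /branch.
set c := s%:R * pend in Y0 *; move=> D0 Z0.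
field.
rewrite [a * 2]mulr_natr W0 Y0 andbT /=.
have -> : (l - a) * (l - a *+ 2) - b ^+ 2 + - c * (l - a *+ 2)
    = (l - a - b ^+ 2 / (l - a *+ 2) - c) * (l - a *+ 2).
  by field; rewrite mulr_natr.
by rewrite mulf_neq0.
Qed.

Lemma H3_goodP s t k : s%:R * pend < l - a -> branch (s%:R * pend) < l - a ->
    k%:R * pend < l - a -> branch (k%:R * pend) < l - a ->
  branch (branch (s%:R * pend)) + branch (branch (k%:R * pend)) + t%:R * pend
    <= l -> H3_good s t k.
Proof.
have [a0 la0 p0 ap] := basics.
move=> sl hs kl hk.
have [al X0 ->] := branch_branch sl hs; have [_ Z0 ->] := branch_branch kl hk.
move=> H; split=> //.
have Y : link ^+ 2 / endw s + link ^+ 2 / endw k <= midw t.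
  by rewrite /midw; lra.
have -> : link ^+ 2 * (endw s + endw k)
    = endw s * (link ^+ 2 / endw s + link ^+ 2 / endw k) * endw k.
  by field; rewrite !gt_eqF.
by rewrite ler_pM2r // ler_pM2l.
Qed.

Lemma H3_sgoodP s t k : s%:R * pend < l - a -> branch (s%:R * pend) < l - a ->
    k%:R * pend < l - a -> branch (k%:R * pend) < l - a ->
  branch (branch (s%:R * pend)) + branch (branch (k%:R * pend)) + t%:R * pend
    < l -> H3_sgood s t k.
Proof.
have [a0 la0 p0 ap] := basics.
move=> sl hs kl hk.
have [al X0 ->] := branch_branch sl hs; have [_ Z0 ->] := branch_branch kl hk.
move=> H; split=> //.
have Y : link ^+ 2 / endw s + link ^+ 2 / endw k < midw t.
  by rewrite /midw; lra.
have -> : link ^+ 2 * (endw s + endw k)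
    = endw s * (link ^+ 2 / endw s + link ^+ 2 / endw k) * endw k.
  by field; rewrite !gt_eqF.
by rewrite ltr_pM2r // ltr_pM2l.
Qed.

Lemma H3_good_sym s t k : H3_good s t k -> H3_good k t s.
Proof.
case=> ? ? ? H; split; rewrite // addrC.
by rewrite (_ : _ * endw s = endw s * midw t * endw k) //; ring.
Qed.

Lemma H3_sgood_sym s t k : H3_sgood s t k -> H3_sgood k t s.
Proof.
case=> ? ? ? H; split; rewrite // addrC.
by rewrite (_ : _ * endw s = endw s * midw t * endw k) //; ring.
Qed.

Lemma H3_sgoodW s t k : H3_sgood s t k -> H3_good s t k.
Proof. by case=> ? ? ? H; split=> //; apply: ltW. Qed.

Lemma H3_good_midw s t k : H3_good s t k -> 0 < midw t.
Proof.
case=> al X0 Z0 H.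
have : 0 < endw s * midw t * endw k.
  apply: lt_le_trans H; apply: mulr_gt0; last exact: addr_gt0.
  by rewrite exprn_gt0 // link_gt0.
by rewrite pmulr_lgt0 // pmulr_rgt0.
Qed.

Lemma endwS s : endw s.+1 = endw s - pend.
Proof. by rewrite /endw -natr1; ring. Qed.

Lemma midwS s : midw s.+1 = midw s - pend.
Proof. by rewrite /midw -natr1; ring. Qed.

Lemma H3_balance s t k : (k.+1 < s)%N -> H3_good s t k ->
  H3_sgood s.-1 t k.+1.
Proof.
have [a0 la0 p0 ap] := basics.
case: s => // s; rewrite ltnS /= => ks gd; have Y0 := H3_good_midw gd.
have [al X0 Z0 H] := gd.
have XZ : endw s <= endw k.+1.
  by rewrite /endw lerD2l lerN2; apply: pend_ler.
move: H XZ X0; rewrite !endwS; set X := endw s; set Z := endw k.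
move=> H XZ X0; split=> //; rewrite -?/X ?endwS -/Z; [lra|lra|].
set Y := midw t in H Y0 *.
have -> : link ^+ 2 * (X + (Z - pend)) = link ^+ 2 * (X - pend + Z) by ring.
apply: le_lt_trans H _.
have -> : (X - pend) * Y * Z = Y * ((X - pend) * Z) by ring.
have -> : X * Y * (Z - pend) = Y * (X * (Z - pend)) by ring.
rewrite ltr_pM2l //; nra.
Qed.

Lemma H3_shift s t k : (s < t)%N -> H3_good s t k ->
  H3_sgood s.+1 t.-1 k.
Proof.
have [a0 la0 p0 ap] := basics.
case: t => // t; rewrite ltnS /= => st gd; have Y0 := H3_good_midw gd.
have [al X0 Z0 H] := gd; have q0 := link_gt0 al.
have YX : midw t < endw s.
  have : s%:R * pend <= t%:R * pend by apply: pend_ler.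
  rewrite /midw /endw; lra.
move: H YX Y0; rewrite !midwS; set X := endw s in X0 *; set Z := endw k in Z0 *.
set Y := midw t; move=> H XY Y0; split=> //; rewrite -?/X ?endwS -/X -/Y -/Z.
  lra.
have H1 : X * (Y - pend) * Z < (X - pend) * Y * Z by rewrite ltr_pM2r //; nra.
apply: le_lt_trans H1; apply: le_trans H.
by rewrite ler_pM2l ?exprn_gt0 //; lra.
Qed.

Lemma H3_good_noend t k : (4 <= t + k)%N -> H3_good 0 t k ->
  exists s' t' k', (s' + t' + k' = t + k)%N /\ H3_sgood s' t' k'.
Proof.
move=> tk gd; case: (leqP 2 k) => k2.
  exists 1%N, t, k.-1; split; first by lia.
  by apply/H3_sgood_sym/H3_balance => //; apply: H3_good_sym.
exists 1%N, t.-1, k; split; first by lia.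
by apply: H3_shift => //; lia.
Qed.

Lemma H3_sgood_of_edge_cherry s t k : (0 < s)%N -> (5 <= s + t + k)%N ->
    s%:R * pend < l - a -> k%:R * pend < l - a ->
    branch (k%:R * pend) < l - a ->
    branch (s%:R * pend) + branch (branch (k%:R * pend)) + t%:R * pend <= l ->
  exists s' t' k', (s' + t' + k' = s + t + k - 1)%N /\ H3_sgood s' t' k'.
Proof.
case: s => // s _ sum sl kl hk H; have [a0 la0 p0 ap] := basics.
have sl' : s%:R * pend < l - a by apply: le_lt_trans sl; apply: pend_ler.
have [hs Es] := branch_subdivide sl.
have hs' := le_lt_trans hs sl.
case: s => [|s] in sum sl H sl' hs Es hs' *.
  have [] := @H3_good_noend t k; [by move: sum; clear; lia| |].
    apply: H3_goodP => //; apply: le_trans H; rewrite !lerD2r.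
    exact: (branch_le hs sl).
  move=> s' [t' [k' [E G]]]; exists s', t', k'; split=> //.
  by move: E sum; clear; lia.
exists s.+1, t, k; split; first by move: sum; clear; lia.
apply: H3_sgoodP => //; apply: lt_le_trans H; rewrite !ltrD2r.
by apply: branch_lt => //; rewrite lt_neqAle Es hs.
Qed.

Lemma H3_sgood_of_edge_edge s t k :
    (0 < s)%N -> (0 < k)%N -> (6 <= s + t + k)%N ->
    s%:R * pend < l - a -> k%:R * pend < l - a ->
    branch (s%:R * pend) + branch (k%:R * pend) + t%:R * pend <= l ->
  exists s' t' k', (s' + t' + k' = s + t + k - 2)%N /\ H3_sgood s' t' k'.
Proof.
move=> s0; case: k => // k _ sum sl kl H; have [a0 la0 p0 ap] := basics.
have kl' : k%:R * pend < l - a by apply: le_lt_trans kl; apply: pend_ler.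
have [hk _] := branch_subdivide kl.
have hk' := le_lt_trans hk kl.
have [||s' [t' [k' [E G]]]] := @H3_sgood_of_edge_cherry s t k s0 _ sl kl' hk'.
- by move: sum; clear; lia.
- apply: le_trans H; rewrite !lerD2r lerD2l; exact: (branch_le hk kl).
by exists s', t', k'; split=> //; move: E sum; clear; lia.
Qed.

Lemma H3_sgood_of_claw s t k : (t <= s)%N -> (t <= k)%N -> (5 <= s + t + k)%N ->
    s%:R * pend < l - a -> t%:R * pend < l - a -> k%:R * pend < l - a ->
    branch (s%:R * pend) + branch (t%:R * pend) + branch (k%:R * pend) <= l ->
  exists s' t' k', (s' + t' + k' = s + t + k - 1)%N /\ H3_sgood s' t' k'.
Proof.
wlog ks : s k / (k <= s)%N.
  move=> W ts tk sum sl tl kl H; case: (leqP k s) => ks; first exact: W.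
  have [||s' [t' [k' [E G]]]] := W k s (ltnW ks) tk ts _ kl tl sl.
  - by move: sum; clear; lia.
  - by rewrite addrAC [X in X + _]addrC addrAC.
  by exists s', t', k'; split=> //; move: E sum; clear; lia.
move=> ts tk sum sl tl kl H; have [a0 la0 p0 ap] := basics.
have as_ := branch_gt sl; have at_ := branch_gt tl; have ak := branch_gt kl.
have hs : branch (s%:R * pend) < l - a by lra.
have hk : branch (k%:R * pend) < l - a by lra.
have Ets : branch (t%:R * pend) <= branch (s%:R * pend).
  by apply: branch_le => //; apply: pend_ler.
have Etk : branch (t%:R * pend) <= branch (k%:R * pend).
  by apply: branch_le => //; apply: pend_ler.
have Et := branchE tl.
set hS := branch (s%:R * pend) in H as_ hs Ets *.
set hT := branch (t%:R * pend) in H at_ Ets Etk Et *.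
set hK := branch (k%:R * pend) in H ak hk Etk *.
have D0 : 0 < hT *+ 2 - a by rewrite mulr2n; lra.
have half v : v < l - a -> hT *+ 2 - a <= l - a - v ->
    branch v <= a + (hT - a) * (l - a - t%:R * pend) / (hT *+ 2 - a).
  move=> vl hv; rewrite /branch lerD2l Et ler_pM2l // lef_pV2 ?posrE //.
  by rewrite subr_gt0.
have bS : branch hS <= a + (hT - a) * (l - a - t%:R * pend) / (hT *+ 2 - a).
  by apply: half => //; rewrite mulr2n; lra.
have bK : branch hK <= a + (hT - a) * (l - a - t%:R * pend) / (hT *+ 2 - a).
  by apply: half => //; rewrite mulr2n; lra.
have [t0|t0] := posnP t; last first.
  exists s, t.-1, k; split; first by move: sum t0; clear; lia.
  apply: H3_sgoodP => //; rewrite -/hS -/hK.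
  have t1 : t.-1%:R = t%:R - 1 :> R.
    by rewrite -[in RHS](prednK t0) -natr1 addrK.
  suff : (hT - a) * (l - a - t%:R * pend) / (hT *+ 2 - a)
      <= (l - a - t%:R * pend) / 2.
    rewrite t1; lra.
  have A0 : 0 <= l - a - t%:R * pend by lra.
  have := mulr_ge0 a0 A0.
  rewrite ler_pdivrMr // [hT *+ 2]mulr2n; lra.
have s0 : (0 < s)%N by move: ks sum t0; clear; lia.
have s1 : (s.-1 < s)%N by rewrite prednK.
exists s.-1, 0%N, k; split; first by move: sum s0 t0; clear; lia.
have sl' : s.-1%:R * pend < s%:R * pend by rewrite ltr_pM2r // ltr_nat.
have hs' : branch (s.-1%:R * pend) < hS by apply: branch_lt.
have bS' : branch (branch (s.-1%:R * pend)) < branch hS by apply: branch_lt.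
apply: H3_sgoodP => //; [exact: lt_trans sl | exact: lt_trans hs|].
have s2 : 2%:R * pend <= s%:R * pend.
  by apply: pend_ler; move: ks sum t0; clear; lia.
have tE : t%:R * pend = 0 by rewrite t0 mul0r.
have hTE : hT = pend by rewrite /hT tE.
rewrite tE subr0 in Et bS bK; rewrite mul0r addr0 -/hK.
suff : (hT - a) * (l - a) / (hT *+ 2 - a) <= (l - a *+ 2) / 2.
  rewrite [a *+ 2]mulr2n; lra.
rewrite ler_pdivrMr // hTE [pend *+ 2]mulr2n [a *+ 2]mulr2n.
have : 0 <= a * (l - pend - pend) by apply: mulr_ge0 => //; lra.
lra.
Qed.

Lemma pend_link_bound : b <= a -> a *+ 2 < l -> 2 * pend <= l - a - link ->
  2 * link ^+ 2 + (link - pend + a) * pend <= pend ^+ 2.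
Proof.
move=> ba al L2; have [a0 la0 p0 ap] := basics.
have [b0 b20] : 0 < b /\ 0 < b ^+ 2 by [].
have q0 := link_gt0 al; have qE := linkE al; have pE := pendE la_gt0.
move: L2 ap q0 qE pE al; move: pend link => P q.
rewrite mulr2n => L2 ap q0 qE pE al.
have [p Pp] : exists p, p = P - a by exists (P - a).
have PE : P = a + p by lra.
rewrite {}PE {Pp} in L2 ap pE *.
have p_gt0 : 0 < p by lra.
have b2a : b ^+ 2 <= a ^+ 2 by apply: lerXn2r; rewrite // nnegrE ltW.
have q2p : q <= 2 * p.
  have : q * (l - a) <= 2 * p * (l - a).
    have -> : 2 * p * (l - a) = 2 * (q * (l - (a + a))) by rewrite qE -pE; ring.
    rewrite mulrCA ler_pM2l //; lra.
  by rewrite ler_pM2r.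
have H : q * (a + q + 2 * p) <= a ^+ 2.
  by apply: le_trans b2a; rewrite -qE ler_pM2l //; lra.
have H2 : q * (q - p) <= 2 * p * p.
  have [?|?] := leP q p; nra.
nra.
Qed.

Lemma link_ge : a *+ 2 < l -> pend - a <= link.
Proof.
move=> al; have [a0 la0 p0 ap] := basics.
have qE := linkE al; have pE := pendE la_gt0.
have q0 := link_gt0 al.
have H : (pend - a) * (l - a *+ 2) <= link * (l - a *+ 2).
  rewrite qE -pE; have := mulr_ge0 a0 (ltW q0); nra.
by rewrite ler_pM2r ?subr_gt0 in H.
Qed.

Lemma H3_sgood_diag s t : a *+ 2 < l -> 0 < endw s ->
  2 * link ^+ 2 < endw s * midw t -> H3_sgood s t s.
Proof.
move=> al X0 H; split=> //.
have -> : link ^+ 2 * (endw s + endw s) = (2 * link ^+ 2) * endw s by ring.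
by rewrite ltr_pM2r.
Qed.

Lemma H3_good_diag s t : H3_good s t s ->
  2 * link ^+ 2 <= endw s * midw t.
Proof.
case=> al X0 _ H; rewrite -(ler_pM2r X0); apply: le_trans H.
by rewrite le_eqVlt; apply/orP; left; apply/eqP; ring.
Qed.

Lemma H3_good_lt s t k : H3_good s t k ->
  [/\ forall m, (m <= s)%N -> m%:R * pend < l - a - link,
      forall m, (m <= k)%N -> m%:R * pend < l - a - link
    & forall m, (m <= t.+1)%N ->
        m%:R * pend + (link - pend + a) < l - a - link].
Proof.
move=> gd; have Y0 := H3_good_midw gd; have [al X0 Z0 _] := gd.
split=> m /pend_ler; rewrite /endw /midw -?natr1 in X0 Y0 Z0 *; lra.
Qed.

Lemma H3_optimal_3m1 N s t k : b <= a -> (s + t + k = 3 * N + 5)%N ->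
    H3_good s t k ->
  (s, t, k) = (N.+2, N.+1, N.+2) \/ H3_sgood N.+2 N.+1 N.+2.
Proof.
move=> ba sum gd; have [a0 la0 p0 ap] := basics.
have [al _ _ _] := gd; have [Hs Hk Ht] := H3_good_lt gd; have d0 := link_ge al.
have q0 := link_gt0 al; have N0 : 0 <= N%:R :> R by [].
have far : N.+3%:R * pend < l - a - link -> H3_sgood N.+2 N.+1 N.+2.
  rewrite -!natr1 => LN; apply: H3_sgood_diag; rewrite // /endw /midw -!natr1.
    lra.
  have L2 : 2 * pend <= l - a - link.
    have : 0 <= N%:R * pend by rewrite mulr_ge0 // ltW.
    lra.
  have q2 : 0 <= 2 * link ^+ 2 by rewrite mulr_ge0 // sqr_ge0.
  have := quadratic_gt p0 q2 (pend_link_bound ba al L2).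
  move=> /(_ (l - a - link - (N%:R + 1 + 1) * pend)) H.
  have {H} := H ltac:(lra); lra.
have [] := boolP [|| N.+3 <= s, N.+3 <= k | N.+3 <= t.+1]%N.
  case/or3P=> /[dup] ?; [move/Hs|move/Hk|move/Ht]; move=> LN; right;
    apply: far.
  - by [].
  - by [].
  - lra.
rewrite !negb_or -!ltnNge => /and3P[s3 k3 t3]; left.
have : [/\ s = N.+2, t = N.+1 & k = N.+2].
  by move: sum s3 k3 t3; clear; split; lia.
by case=> -> -> ->.
Qed.

Lemma H3_optimal_3m N s t k : b <= a -> (s + t + k = 3 * N + 4)%N ->
    H3_good s t k -> (s, t, k) = (N.+2, N, N.+2) \/ H3_sgood N.+2 N N.+2.
Proof.
wlog ks : s k / (k <= s)%N.
  move=> W ba sum gd; case: (leqP k s) => ks; first exact: W.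
  have [|[-> -> ->]|] := W k s (ltnW ks) ba _ (H3_good_sym gd).
  - by move: sum; clear; lia.
  - by left.
  - by right.
move=> ba sum gd; have [a0 la0 p0 ap] := basics.
have [al _ _ H] := gd; have [Hs Hk Ht] := H3_good_lt gd; have d0 := link_ge al.
have q0 := link_gt0 al; have N0 : 0 <= N%:R :> R by [].
have NP0 : 0 <= N%:R * pend by rewrite mulr_ge0 // ltW.
have near : N.+2%:R * pend < l - a - link ->
    2 * link ^+ 2 + (link - pend + a) * pend <= pend ^+ 2.
  move=> LN; rewrite -!natr1 in LN; apply: pend_link_bound => //; lra.
have far : N.+3%:R * pend < l - a - link -> H3_sgood N.+2 N N.+2.
  move=> LN; have nr := near (le_lt_trans (pend_ler (leqnSn _)) LN).
  rewrite -!natr1 in LN.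
  apply: H3_sgood_diag; rewrite // /endw /midw -!natr1; first lra.
  have q2 : 0 <= 2 * link ^+ 2 by rewrite mulr_ge0 // sqr_ge0.
  have {}nr := quadratic_gt p0 q2 nr.
  have py : pend < l - a - link - (N%:R + 1 + 1) * pend by lra.
  have := nr _ py; have := mulr_gt0 p0 (lt_trans p0 py); lra.
have [] := boolP [|| N.+3 <= s, N.+3 <= k | N.+3 <= t.+1]%N.
  case/or3P=> /[dup] ?; [move/Hs|move/Hk|move/Ht]; move=> LN; right;
    apply: far.
  - by [].
  - by [].
  - lra.
rewrite !negb_or -!ltnNge => /and3P[s3 k3 t3].
have : (s = N.+2 /\ t = N /\ k = N.+2) \/ (s = N.+2 /\ t = N.+1 /\ k = N.+1).
  by move: sum s3 k3 t3 ks; clear; lia.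
case=> [] [Es [Et Ek]]; first by left; rewrite Es Et Ek.
right; subst s t k; have Ls := Hs _ (leqnn _); have Lt := Ht _ (leqnn _).
have nr := near Ls.
apply: H3_sgood_diag => //; first by rewrite /endw; lra.
move: H; rewrite /endw /midw.
rewrite -?[N.+2%:R]natr1 -![N.+1%:R]natr1 in Ls Lt *; move: Ls Lt nr.
move: (N%:R : R) => r.
set y := l - a - link - (r + 1 + 1) * pend.
set d := link - pend + a.
move=> Ls Lt nr.
have -> : l - a *+ 2 - link *+ 2 - r * pend = y + pend - d.
  by rewrite /y /d; ring.
have -> : l - a *+ 2 - link *+ 2 - (r + 1) * pend = y - d.
  by rewrite /y /d; ring.
have -> : l - a - link - (r + 1) * pend = y + pend by rewrite /y; ring.
have yd : 0 < y - d by rewrite /y /d in Lt *; lra.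
have dd : 0 <= d by rewrite /d; lra.
have -> : y * (y + pend - d) = y * (y + pend) - d * y by ring.
rewrite [y + (y + pend)]addrA => H.
by apply: quadratic_of_cubic p0 dd yd _ _; rewrite ?exprn_gt0 // -mulr2n.
Qed.

Lemma H3_optimal_3m2 N s t k : b <= a -> (s + t + k = 3 * N + 6)%N ->
    H3_good s t k -> (s, t, k) = (N.+3, N, N.+3) \/ H3_sgood N.+3 N N.+3.
Proof.
wlog ks : s k / (k <= s)%N.
  move=> W ba sum gd; case: (leqP k s) => ks; first exact: W.
  have [|[-> -> ->]|] := W k s (ltnW ks) ba _ (H3_good_sym gd).
  - by move: sum; clear; lia.
  - by left.
  - by right.
move=> ba sum gd; have [a0 la0 p0 ap] := basics.
have [al _ _ H] := gd; have [Hs Hk Ht] := H3_good_lt gd; have d0 := link_ge al.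
have q0 := link_gt0 al; have N0 : 0 <= N%:R :> R by [].
have NP0 : 0 <= N%:R * pend by rewrite mulr_ge0 // ltW.
have q2 : 0 <= 2 * link ^+ 2 by rewrite mulr_ge0 // sqr_ge0.
have far : N.+4%:R * pend < l - a - link -> H3_sgood N.+3 N N.+3.
  move=> LN; have L2 : 2 * pend <= l - a - link.
    by apply: le_trans (ltW LN); apply: (@pend_ler 2).
  have nr := quadratic_gt p0 q2 (pend_link_bound ba al L2).
  rewrite -!natr1 in LN.
  apply: H3_sgood_diag; rewrite // /endw /midw -!natr1; first by lra.
  have py : pend < l - a - link - (N%:R + 1 + 1 + 1) * pend by lra.
  have := nr _ py; have := mulr_gt0 p0 (lt_trans p0 py); lra.
have [] := boolP [|| N.+4 <= s, N.+4 <= k | N.+4 <= t.+1]%N.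
  case/or3P=> /[dup] ?; [move/Hs|move/Hk|move/Ht]; move=> LN; right;
    apply: far.
  - by [].
  - by [].
  - lra.
rewrite !negb_or -!ltnNge => /and3P[s4 k4 t4].
have centre : H3_good N.+2 N.+2 N.+2 -> H3_sgood N.+3 N N.+3.
  move=> gc; have [_ _ Hc] := H3_good_lt gc; have LN := Hc _ (leqnn _).
  have := H3_good_diag gc; rewrite /endw /midw => Hd.
  apply: H3_sgood_diag; rewrite // /endw /midw -!natr1 in LN Hd *; first by lra.
  have : 0 < pend * (l - a - link - (N%:R + 1 + 1 + 1) * pend).
    apply: mulr_gt0; lra.
  have : 0 <= pend * (link - pend + a) by apply: mulr_ge0; lra.
  lra.
have : (s = N.+3 /\ t = N /\ k = N.+3) \/ (s = N.+3 /\ t = N.+1 /\ k = N.+2) \/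
    (s = N.+2 /\ t = N.+2 /\ k = N.+2) \/ (s = N.+3 /\ t = N.+2 /\ k = N.+1).
  by move: sum s4 k4 t4 ks; clear; lia.
case=> [|[|[]]] [Es [Et Ek]]; subst s t k; first by left.
- right; have Ls := Hs _ (leqnn _); have Lt := Ht _ (leqnn _).
  apply: H3_sgood_diag => //; first by rewrite /endw; lra.
  move: H; rewrite /endw /midw.
  rewrite -?[N.+3%:R]natr1 -?[N.+2%:R]natr1 -![N.+1%:R]natr1 in Ls Lt *.
  move: Ls Lt; move: (N%:R : R) => r.
  set y := l - a - link - (r + 1 + 1) * pend.
  set d := link - pend + a.
  move=> Ls Lt.
  have -> : l - a *+ 2 - link *+ 2 - r * pend = y + pend - d
    by rewrite /y /d; ring.
  have -> : l - a *+ 2 - link *+ 2 - (r + 1) * pend = y - d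
    by rewrite /y /d; ring.
  have -> : l - a - link - (r + 1 + 1 + 1) * pend = y - pend.
    by rewrite /y; ring.
  have py : 0 < y - pend by rewrite /y /d in Ls *; lra.
  have dd : 0 <= d by rewrite /d; lra.
  exact: quadratic_of_cubic2.
- by right; apply: centre.
- by right; apply: centre; apply: H3_sgoodW; apply: H3_balance gd.
Qed.

End Branch.

(** * Perron eigenvectors *)

Section Rayleigh.
Import classical_sets topology normedtype derive.
Local Open Scope classical_set_scope.
Local Open Scope ring_scope.
Import numFieldNormedType.Exports.

Lemma rayleigh_max (R : realType) n (A : 'M[R]_n) : (0 < n)%N ->
  exists2 v : 'rV[R]_n, \sum_i v 0 i * v 0 i = 1 &
    forall w : 'rV[R]_n, \sum_i w 0 i * w 0 i = 1 ->
      \sum_i \sum_j w 0 i * A i j * w 0 j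
        <= \sum_i \sum_j v 0 i * A i j * v 0 j.
Proof.
case: n A => // n A _.
pose K := [set v : 'rV[R]_n.+1 | \sum_i v 0 i * v 0 i = 1].
have coordM (f g : 'rV[R]_n.+1 -> R) :
    continuous f -> continuous g -> continuous (fun v => f v * g v).
  by move=> cf cg v; exact: (cvgM (cf v) (cg v)).
have contS (F : 'I_n.+1 -> 'rV[R]_n.+1 -> R) :
    (forall i, continuous (F i)) -> continuous (fun v => \sum_i F i v).
  by move=> cF; apply: continuous_big => //; exact: add_continuous.
have K0 : K !=set0.
  exists (delta_mx 0 0); rewrite /K /= (bigD1 ord0) //= big1.
    by rewrite addr0 mxE !eqxx mulr1.
  by move=> i i0; rewrite mxE (negbTE i0) andbF mul0r.
have cK : compact K.
  apply: bounded_closed_compact.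
    exists 1; split; first exact: num_real.
    move=> M M1 v Kv /=; rewrite [leLHS]/Num.norm /= mx_normrE.
    apply: bigmax_le => [|[z i] _ /=]; first by lra.
    apply: le_trans (ltW M1); rewrite (ord1 z).
    rewrite -(@ler_pXn2r _ 2) ?nnegrE // expr1n -normrX ger0_norm ?sqr_ge0 //.
    rewrite -Kv (bigD1 i) //= expr2 lerDl; apply: sumr_ge0 => j _.
    by rewrite -expr2 sqr_ge0.
  apply: (@preimage_closed _ _ (fun v : 'rV[R]_n.+1 => \sum_i v 0 i * v 0 i)
      [set 1]).
      by move=> v _; apply: contS => i; apply: (coordM); exact: coord_continuous.
    exact: closed_eq.
have [|v vK vmax] := EVT_max_rV K0 cK (f := fun v : 'rV[R]_n.+1 =>
    \sum_i \sum_j v 0 i * A i j * v 0 j).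
  apply: continuous_subspaceT; apply: (contS) => i; apply: (contS) => j.
  apply: (coordM); last exact: coord_continuous.
  by apply: (coordM); [exact: coord_continuous | exact: cst_continuous].
exists v; first by move: vK; rewrite inE.
by move=> w Kw; apply: vmax; rewrite inE.
Qed.

End Rayleigh.

Section GraphSpectrum.
Variables (R : realType) (a : R) (G : sgraph).
Implicit Types x y z : G -> R.

Definition Aop x (u : G) : R := \sum_(w | adj u w) (a * x u + (1 - a) * x w).

Definition dot x y : R := \sum_u x u * y u.

Lemma sum_enum_val (F : G -> R) :
  \sum_(i < #|G|) F (enum_val i) = \sum_u F u.
Proof. by rewrite [RHS]big_enum_val. Qed.

Lemma row_mul_Aalpha x j :
  ((\row_i x (enum_val i)) *m Aalpha_mx a G) 0 j = Aop x (enum_val j).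
Proof.
rewrite mxE; under eq_bigr => i _.
  rewrite !mxE mulrDr (_ : enum_val j = enum_val j) //.
  over.
rewrite big_split /= (bigD1 j) //= eqxx mulr1n big1 ?addr0; last first.
  by move=> i /negbTE ij; rewrite ij mulr0n mulr0 mulr0.
rewrite /Aop big_split /= sumr_const; congr (_ + _).
  by rewrite -[RHS]mulr_natr mulrCA mulrA /degree cardsE.
rewrite (sum_enum_val (fun u => x u * ((1 - a) * (adj u (enum_val j))%:R))).
rewrite [RHS]big_mkcond; apply: eq_bigr => u _; rewrite adj_sym.
by case: adj; rewrite ?mulr1 ?mulr0 // mulrC.
Qed.

Lemma Aalpha_eigenvalueP l : eigenvalue (Aalpha_mx a G) l <->
  exists2 x, exists u, x u != 0 & forall u, Aop x u = l * x u.
Proof.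
split=> [/eigenvalueP[v vA v0]|[x [u xu] xA]].
  exists (fun u => v 0 (enum_rank u)).
    have [i vi] : exists i, v 0 i != 0.
      apply/existsP; apply: contraNT v0 => /existsPn v0.
      by apply/eqP/rowP => i; rewrite mxE; apply/eqP/negPn/v0.
    by exists (enum_val i); rewrite enum_valK.
  move=> u; rewrite -[u in LHS]enum_rankK -row_mul_Aalpha.
  rewrite (_ : \row_i _ = v) ?vA ?mxE //.
  by apply/rowP => i; rewrite mxE enum_valK.
apply/eigenvalueP; exists (\row_i x (enum_val i)).
  by apply/rowP => j; rewrite row_mul_Aalpha xA !mxE.
apply: contraNneq xu => /rowP/(_ (enum_rank u)).
by rewrite !mxE enum_rankK => ->.
Qed.

Lemma dot_Aop_sym x y : dot y (Aop x) = dot x (Aop y).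
Proof.
rewrite /dot /Aop.
have E z t : \sum_u z u * (\sum_(w | adj u w) (a * t u + (1 - a) * t w))
    = \sum_u \sum_(w | adj u w) a * (z u * t u)
      + \sum_u \sum_(w | adj u w) (1 - a) * (z u * t w).
  rewrite -big_split /=; apply: eq_bigr => u _.
  rewrite mulr_sumr -big_split /=; apply: eq_bigr => w _; ring.
rewrite !E; congr (_ + _).
  by apply: eq_bigr => u _; apply: eq_bigr => w _; rewrite (mulrC (y u)).
rewrite (exchange_big_dep predT) //=; apply: eq_bigr => u _.
by apply: eq_big => [w|w _]; rewrite 1?adj_sym // (mulrC (y w)).
Qed.

Lemma dot_ge0 x : 0 <= dot x x.
Proof. by apply: sumr_ge0 => u _; rewrite -expr2 sqr_ge0. Qed.

Lemma dot_eq0 x : dot x x = 0 -> forall u, x u = 0.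
Proof.
move=> /eqP; rewrite psumr_eq0; last by move=> u _; rewrite -expr2 sqr_ge0.
move=> /allP h u; apply/eqP; rewrite -sqrf_eq0 expr2; apply: h.
by rewrite mem_index_enum.
Qed.

Lemma rayleigh_graph (u0 : G) : exists2 x, dot x x = 1 &
  forall y, dot y (Aop y) <= dot x (Aop x) * dot y y.
Proof.
have Gpos : (0 < #|G|)%N by apply/card_gt0P; exists u0.
have [v v1 vmax] := rayleigh_max (Aalpha_mx a G) Gpos.
have E (y : G -> R) : \sum_(i < #|G|) \sum_(j < #|G|)
    (\row_(i < #|G|) y (enum_val i)) 0 i
    * Aalpha_mx a G i j * (\row_(i < #|G|) y (enum_val i)) 0 j = dot y (Aop y).
  rewrite exchange_big /= /dot -(sum_enum_val (fun u => y u * Aop y u)).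
  apply: eq_bigr => j _.
  rewrite -row_mul_Aalpha mxE -mulr_suml mulrC; congr (_ * _).
  by rewrite mxE.
have D (y : G -> R) : \sum_(i < #|G|) (\row_(i < #|G|) y (enum_val i)) 0 i
     * (\row_(i < #|G|) y (enum_val i)) 0 i = dot y y.
  rewrite -[RHS](sum_enum_val (fun u => y u * y u)).
  by apply: eq_bigr => j _; rewrite mxE.
pose x u := v 0 (enum_rank u).
have vE : v = \row_(i < #|G|) x (enum_val i).
  by apply/rowP => i; rewrite mxE /x enum_valK.
rewrite vE in v1 vmax; rewrite D in v1; exists x => // y.
have [y0|y0] := eqVneq (dot y y) 0.
  rewrite y0 mulr0 /dot big1 // => u _.
  by rewrite (dot_eq0 y0) mul0r.
have yp : 0 < dot y y by rewrite lt_def y0 dot_ge0.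
pose c := Num.sqrt (dot y y).
have c0 : 0 < c by rewrite sqrtr_gt0.
have c2 : c * c = dot y y by rewrite -expr2 sqr_sqrtr // ltW.
pose z u := y u / c.
have zz : dot z z = 1.
  have -> : dot z z = dot y y / (c * c).
    rewrite /dot mulr_suml; apply: eq_bigr => u _; rewrite /z; field.
    by rewrite gt_eqF.
  by rewrite c2 divff.
have zA : dot z (Aop z) = dot y (Aop y) / dot y y.
  rewrite -c2 /dot mulr_suml; apply: eq_bigr => u _.
  have -> : Aop z u = Aop y u / c.
    rewrite /Aop mulr_suml; apply: eq_bigr => w _; rewrite /z; field.
    by rewrite gt_eqF.
  by rewrite /z; field; rewrite gt_eqF.
have := vmax (\row_(i < #|G|) z (enum_val i)).
by rewrite D !E zA zz ler_pdivrMr // => /(_ erefl).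
Qed.

Lemma rayleigh_eq_eigen M z :
  (forall y, dot y (Aop y) <= M * dot y y) -> dot z (Aop z) = M * dot z z ->
  forall u, Aop z u = M * z u.
Proof.
move=> max zM; pose r u := Aop z u - M * z u.
suff r0 : dot r r = 0.
  by move=> u; apply/eqP; rewrite -subr_eq0; apply/eqP; exact: (dot_eq0 r0).
apply/eqP; rewrite eq_le dot_ge0 andbT leNgt; apply/negP => rr.
have lin t y : dot (fun u => z u + t * y u) (Aop (fun u => z u + t * y u))
    = dot z (Aop z) + t * dot y (Aop z) + t * dot z (Aop y)
      + t ^+ 2 * dot y (Aop y).
  rewrite /dot !mulr_sumr -!big_split /=; apply: eq_bigr => u _.
  have -> : Aop (fun u => z u + t * y u) u = Aop z u + t * Aop y u.
    rewrite /Aop mulr_sumr -big_split; apply: eq_bigr => w _ /=; ring.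
  ring.
have lin2 t y : dot (fun u => z u + t * y u) (fun u => z u + t * y u)
    = dot z z + t * dot y z + t * dot y z + t ^+ 2 * dot y y.
  rewrite /dot !mulr_sumr -!big_split /=.
  by apply: eq_bigr => u _; ring.
have rz : dot r (Aop z) = M * dot r z + dot r r.
  rewrite /dot mulr_sumr -big_split; apply: eq_bigr => u _ /=.
  by rewrite /r; ring.
have c0 : dot r (Aop r) - M * dot r r <= 0 by rewrite subr_le0 max.
set c := dot r (Aop r) - M * dot r r in c0.
have c1 : 0 < 1 - c by lra.
pose t := dot r r / (1 - c).
have t0 : 0 < t by rewrite divr_gt0.
have := max (fun u => z u + t * r u); rewrite lin lin2 zM (dot_Aop_sym r z) rz.
have tc : t * c = t - dot r r by rewrite /t; field; rewrite gt_eqF.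
have : 0 < t * (dot r r + t) by rewrite mulr_gt0 // addr_gt0.
have -> : dot r (Aop r) = c + M * dot r r by rewrite /c; ring.
have -> : t ^+ 2 * (c + M * dot r r)
  = t * (t - dot r r) + t ^+ 2 * (M * dot r r) by rewrite -tc; ring.
lra.
Qed.

Lemma Aop_norm_ge x : 0 <= a < 1 ->
  dot x (Aop x) <= dot (fun u => `|x u|) (Aop (fun u => `|x u|)).
Proof.
case/andP=> a0 a1; apply: ler_sum => u _; rewrite /Aop !mulr_sumr.
apply: ler_sum => w _; rewrite !mulrDr; apply: lerD.
  by rewrite mulrCA [leRHS]mulrCA ler_wpM2l // -normrM ler_norm.
rewrite mulrCA [leRHS]mulrCA ler_wpM2l -?normrM ?ler_norm //; lra.
Qed.

Lemma perron (u0 : G) : 0 <= a < 1 -> connected_graph G ->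
  exists l, [/\ Aalpha_index a G l &
    exists2 x, forall u, 0 < x u & forall u, Aop x u = l * x u].
Proof.
move=> a01 conG; have [v v1 vmax] := rayleigh_graph u0.
set M := dot v (Aop v) in vmax; pose x u := `|v u|.
have x1 : dot x x = 1.
  rewrite -v1; apply: eq_bigr => u _.
  by rewrite /x -normrM ger0_norm // -expr2 sqr_ge0.
have xM : dot x (Aop x) = M * dot x x.
  apply/eqP; rewrite eq_le vmax x1 mulr1; exact: Aop_norm_ge.
have xE := rayleigh_eq_eigen vmax xM.
have x_ge0 u : 0 <= x u by rewrite normr_ge0.
have [a0 a1] := andP a01.
have zero u w : x u = 0 -> adj u w -> x w = 0.
  move=> xu uw; have /eqP := xE u; rewrite xu mulr0 /Aop psumr_eq0.
    move=> /allP/(_ w (mem_index_enum _)) /implyP/(_ uw).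
    rewrite xu mulr0 add0r mulf_eq0 subr_eq0 => /orP[/eqP a1'|/eqP //].
    by move: a1; rewrite -a1' ltxx.
  move=> w' _; rewrite xu mulr0 add0r mulr_ge0 //; lra.
have x_gt0 u : 0 < x u.
  rewrite lt_def x_ge0 andbT; apply/eqP => xu.
  have x0 w : x w = 0.
    have /connectP[p] := conG u w.
    elim: p u xu => [|w' p IH] u xu /=; first by move=> _ ->.
    by case/andP=> uw' pw' E; apply: (IH w') => //; exact: zero uw'.
  move: x1; rewrite /dot big1; last by move=> w _; rewrite x0 mul0r.
  by move/eqP; rewrite eq_sym oner_eq0.
exists M; split; last by exists x.
split=> [|mu /Aalpha_eigenvalueP[y [u yu] yA]].
  by apply/Aalpha_eigenvalueP; exists x => //; exists u0; rewrite gt_eqF.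
have := vmax y; have -> : dot y (Aop y) = mu * dot y y.
  by rewrite /dot mulr_sumr; apply: eq_bigr => w _; rewrite yA; ring.
rewrite ler_pM2r // lt_def dot_ge0 andbT.
by apply: contraNneq yu => /dot_eq0 ->.
Qed.

Lemma index_lt l x lam y :
    (forall u, 0 < x u) -> (forall u, Aop x u = l * x u) ->
    (forall u, 0 < y u) -> (forall u, Aop y u <= lam * y u) ->
    (exists u, Aop y u < lam * y u) -> l < lam.
Proof.
move=> x0 xE y0 yle [u ylt].
have xy : 0 < dot x y.
  rewrite /dot (bigD1 u) //= ltr_wpDr ?mulr_gt0 //.
  by apply: sumr_ge0 => w _; rewrite mulr_ge0 // ltW.
rewrite -(ltr_pM2r xy).
have -> : l * dot x y = dot x (Aop y).
  rewrite dot_Aop_sym /dot mulr_sumr; apply: eq_bigr => w _; rewrite xE; ring.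
have -> : lam * dot x y = dot x (fun u => lam * y u).
  rewrite /dot mulr_sumr; apply: eq_bigr => w _; ring.
rewrite /dot (bigD1 u) //= [ltRHS](bigD1 u) //= ltr_leD ?ltr_pM2l //.
by apply: ler_sum => w _; rewrite ler_pM2l.
Qed.

End GraphSpectrum.

(** * The trees H3 *)

Lemma card_H3 s t k : #|H3 s t k| = (5 + (s + t + k))%N.
Proof. by rewrite !card_sum !card_ord. Qed.

Lemma connected_H3 s t k : connected_graph (H3 s t k).
Proof.
pose c : H3 s t k := inl (@Ordinal 5 2 isT).
have sym : connect_sym (@adj (H3 s t k)).
  by apply: sym_connect_sym; exact: adj_sym.
suff toc x : connect (@adj (H3 s t k)) c x.
  by move=> x y; apply: (@connect_trans _ _ c); rewrite // sym.
have core i : connect (@adj (H3 s t k)) c (inl i).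
  have step (j j' : 'I_5) : adj (inl j : H3 s t k) (inl j') ->
      connect (@adj (H3 s t k)) c (inl j) ->
      connect (@adj (H3 s t k)) c (inl j').
    by move=> ij ci; apply: connect_trans ci (connect1 ij).
  have c1 : connect (@adj (H3 s t k)) c (inl (@Ordinal 5 1 isT)).
    by apply: (step (@Ordinal 5 2 isT)).
  have c3 : connect (@adj (H3 s t k)) c (inl (@Ordinal 5 3 isT)).
    by apply: (step (@Ordinal 5 2 isT)).
  case: i => [[|[|[|[|[|//]]]]] lti]; rewrite (bool_irrelevance lti isT) //.
  - exact: step c1.
  - exact: step c3.
case: x => [i|x]; first exact: core.
have [i ix] : exists i, adj (inl i : H3 s t k) (inr x).
  case: x => [[i|i]|i]; by [exists (@Ordinal 5 0 isT) |
    exists (@Ordinal 5 2 isT) | exists (@Ordinal 5 4 isT)].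
exact: connect_trans (core i) (connect1 ix).
Qed.

Lemma independent_card_le (G : sgraph) (S : {set G}) (e : seq (G * G)) :
  independent S -> all (fun p => adj p.1 p.2) e ->
  uniq (unzip1 e ++ unzip2 e) -> (#|S| + size e <= #|G|)%N.
Proof.
move=> /forall_inP indS adje une.
have : (size e <= count [pred x | x \notin S] (unzip1 e ++ unzip2 e))%N.
  rewrite count_cat; elim: e adje {une} => //= -[x y] e IH /andP[/= xy adje].
  have -> : size e = (size e + 0)%N by rewrite addn0.
  rewrite addnACA -addn1 addnC leq_add ?addn0 ?IH //.
  case: (boolP (x \in S)) => // xS; rewrite add0n lt0b.
  by apply: contraL xy => yS; move/forall_inP: (indS _ xS) => /(_ _ yS).
move=> le_e; rewrite -(cardsC S) leq_add2l; apply: leq_trans le_e _.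
rewrite -size_filter cardE; apply: uniq_leq_size; first exact: filter_uniq.
by move=> x; rewrite mem_filter mem_enum in_setC => /andP[].
Qed.

Lemma independence_number_H3 s t k : (0 < s + t + k)%N ->
  independence_number (H3 s t k) = (s + t + k + 2)%N.
Proof.
move=> stk; apply/eqP; rewrite eqn_leq; apply/andP; split.
  apply/bigmax_leqP => S indS.
  pose v i (lti : (i < 5)%N) : H3 s t k := inl (Ordinal lti).
  suff [e [ae ue se]] : exists e : seq (H3 s t k * H3 s t k),
      [/\ all (fun p => adj p.1 p.2) e, uniq (unzip1 e ++ unzip2 e)
        & size e = 3%N].
    have := independent_card_le indS ae ue; rewrite card_H3 se; lia.
  have [t0|t0] := posnP t; last first.
    exists [:: (v 0 isT, v 1 isT); (v 2 isT, inr (inl (inr (Ordinal t0))));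
      (v 3 isT, v 4 isT)]; split=> //.
  have [s0|s0] := posnP s; last first.
    exists [:: (v 0 isT, inr (inl (inl (Ordinal s0)))); (v 1 isT, v 2 isT);
      (v 3 isT, v 4 isT)]; split=> //.
  have k0 : (0 < k)%N by lia.
  exists [:: (v 4 isT, inr (inr (Ordinal k0))); (v 1 isT, v 0 isT);
      (v 3 isT, v 2 isT)]; split=> //.
pose S : {set H3 s t k} := [set x | match x : H3_vertex s t k with
  | inl i => (i == 1 :> nat) || (i == 3 :> nat) | inr _ => true end].
have indS : independent S.
  apply/forall_inP => x; rewrite inE => xS; apply/forall_inP => y.
  rewrite inE => yS; move: x y xS yS.
  by case=> [[[|[|[|[|[|//]]]]] lti]|[[i|i]|i]];
     case=> [[[|[|[|[|[|//]]]]] ltj]|[[j|j]|j]].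
apply: leq_trans (leq_bigmax_cond _ indS).
pose A : {set H3 s t k} := [set inl (@Ordinal 5 0 isT);
  inl (@Ordinal 5 2 isT); inl (@Ordinal 5 4 isT)].
have -> : S = ~: A.
  apply/setP; case=> [[[|[|[|[|[|//]]]]] lti]|[[i|i]|i]]; by rewrite !inE.
have cA : #|A| = 3%N by rewrite /A setUC cardsU1 cards2 !inE.
have := cardsC A; rewrite card_H3 cA => E.
by rewrite -(leq_add2l 3) E; lia.
Qed.

Section H3Index.
Variables (R : realType) (a : R) (s t k : nat).

Lemma sum_H3 (F : H3 s t k -> R) : \sum_u F u =
  F (inl (@Ordinal 5 0 isT)) + F (inl (@Ordinal 5 1 isT))
  + F (inl (@Ordinal 5 2 isT)) + F (inl (@Ordinal 5 3 isT))
  + F (inl (@Ordinal 5 4 isT)) + \sum_(i < s) F (inr (inl (inl i)))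
  + \sum_(i < t) F (inr (inl (inr i))) + \sum_(i < k) F (inr (inr i)).
Proof.
rewrite big_sumType /= !big_sumType /= !big_ord_recl big_ord0 addr0 !addrA.
by congr (_ + _ + _ + _ + _ + _ + _ + _); congr (F (inl _)); apply: val_inj.
Qed.

Lemma H3_index_lt l : 0 <= a < 1 -> H3_sgood a (1 - a) l s t k ->
  exists2 mu, Aalpha_index a (H3 s t k) mu & mu < l.
Proof.
move=> /[dup] a01 /andP[a0 a1] [al X0 Z0 H].
have [mu [idx [x x0 xE]]] :=
  perron (inl ord0 : H3 s t k) a01 (@connected_H3 s t k).
exists mu => //.
have b0 : 0 < 1 - a by rewrite subr_gt0.
have la : a < l by rewrite mulr2n in al; lra.
have W0 : 0 < l - a *+ 2 by rewrite subr_gt0.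
have q0 := link_gt0 b0 al.
set q := link a (1 - a) l in q0 H.
set P := pend a (1 - a) l.
set X := endw a (1 - a) l s in X0 H; set Z := endw a (1 - a) l k in Z0 H.
have [y1 y10 Ey1] : exists2 y1, 0 < y1 & X * y1 = q.
  by exists (q / X); [exact: divr_gt0 | rewrite mulrC divfK ?gt_eqF].
have [y3 y30 Ey3] : exists2 y3, 0 < y3 & Z * y3 = q.
  by exists (q / Z); [exact: divr_gt0 | rewrite mulrC divfK ?gt_eqF].
have [beta [beta0 betaE qE]] : exists beta,
    [/\ 0 < beta, beta * (l - a *+ 2) = 1 - a & q = (1 - a) * beta].
  exists ((1 - a) / (l - a *+ 2)); split; first exact: divr_gt0.
    by rewrite divfK ?gt_eqF.
  by rewrite /q /link expr2 mulrA.
have [gam [gam0 gamE PE]] : exists gam,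
    [/\ 0 < gam, gam * (l - a) = 1 - a & P = a + (1 - a) * gam].
  have la0 : 0 < l - a by rewrite subr_gt0.
  exists ((1 - a) / (l - a)); split; first exact: divr_gt0.
    by rewrite divfK ?gt_eqF.
  by rewrite /P /pend /branch subr0 expr2 mulrA.
have Y2 : q * y1 + q * y3 < midw a (1 - a) l t.
  rewrite -(ltr_pM2l X0) -(ltr_pM2r Z0); apply: le_lt_trans H.
  have -> : X * (q * y1 + q * y3) * Z = q * Z * (X * y1) + q * X * (Z * y3).
    by ring.
  by rewrite Ey1 Ey3 le_eqVlt; apply/orP; left; apply/eqP; ring.
pose y (u : H3 s t k) := match u : H3_vertex s t k with
  | inl i => nth 0 [:: y1; beta * (y1 + 1); 1; beta * (1 + y3); y3] i
  | inr (inl (inl _)) => gam * y1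
  | inr (inl (inr _)) => gam
  | inr (inr _) => gam * y3 end.
have y_gt0 u : 0 < y u.
  case: u => [[[|[|[|[|[|//]]]]] lti]|[[i|i]|i]] //=; apply: mulr_gt0 => //;
  exact: addr_gt0.
have gapE u : l * y u - Aop a y u = if u == inl (@Ordinal 5 2 isT)
    then midw a (1 - a) l t - (q * y1 + q * y3) else 0.
  rewrite /Aop big_mkcond sum_H3.
  have XE : X = l - a - q - s%:R * P by [].
  have ZE : Z = l - a - q - k%:R * P by [].
  have YE : midw a (1 - a) l t = l - a *+ 2 - q *+ 2 - t%:R * P by [].
  case: u => [[[|[|[|[|[|//]]]]] ltu]|[[i|i]|i]] /=; rewrite /H3_adj /=;
   rewrite ?sumr_const ?card_ord ?addr0 ?add0r ?mul0rn ?addr0.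
  - by transitivity (X * y1 - q); [rewrite XE PE qE; ring | rewrite Ey1 subrr].
  - transitivity ((beta * (l - a *+ 2) - (1 - a)) * (y1 + 1)); first ring.
    by rewrite betaE subrr mul0r.
  - by rewrite YE PE qE; ring.
  - transitivity ((beta * (l - a *+ 2) - (1 - a)) * (1 + y3)); first ring.
    by rewrite betaE subrr mul0r.
  - by transitivity (Z * y3 - q); [rewrite ZE PE qE; ring | rewrite Ey3 subrr].
  - transitivity ((gam * (l - a) - (1 - a)) * y1); first ring.
    by rewrite gamE subrr mul0r.
  - transitivity (gam * (l - a) - (1 - a)); first ring.
    by rewrite gamE subrr.
  - transitivity ((gam * (l - a) - (1 - a)) * y3); first ring.
    by rewrite gamE subrr mul0r.
apply: (index_lt x0 xE y_gt0).
  move=> u; rewrite -subr_ge0 gapE; case: ifP => // _.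
  by rewrite subr_ge0 ltW.
by exists (inl (@Ordinal 5 2 isT)); rewrite -subr_gt0 gapE eqxx subr_gt0.
Qed.
End H3Index.

Lemma spanning_index_lt (R : realType) (a l : R) (H G : sgraph) (phi : H -> G)
    (x : G -> R) (u0 : H) :
    0 <= a < 1 -> connected_graph H -> bijective phi ->
    (forall u v : H, adj u v -> adj (phi u) (phi v)) ->
    (forall w, 0 < x w) -> (forall w, Aop a x w = l * x w) ->
  (forall u v : H, adj (phi u) (phi v) = adj u v) \/
  exists2 mu, Aalpha_index a H mu & mu < l.
Proof.
move=> a01 conH bphi hom x0 xE; have [a0 a1] := andP a01.
have [/forallP iso|] :=
  boolP [forall u : H, [forall v : H, adj (phi u) (phi v) ==> adj u v]].
  left=> u v; apply/idP/idP; last exact: hom.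
  by have /forallP/(_ v)/implyP := iso u.
rewrite negb_forall => /existsP[u1]; rewrite negb_forall => /existsP[v1].
rewrite negb_imply => /andP[uv1 nuv1]; right.
have [mu [idx [z z0 zE]]] := perron u0 a01 conH.
exists mu => //.
pose y u := x (phi u).
have term (u v : H) : 0 < a * y u + (1 - a) * y v.
  apply: ltr_wpDl; first by apply: mulr_ge0 => //; exact: ltW (x0 _).
  by apply: mulr_gt0; rewrite ?subr_gt0 // x0.
have AE u : l * y u
    = \sum_(v : H | adj (phi u) (phi v)) (a * y u + (1 - a) * y v).
  by rewrite /y -xE /Aop (reindex phi) //=; apply: onW_bij.
have le_term u v : (if adj u v then a * y u + (1 - a) * y v else 0)
    <= (if adj (phi u) (phi v) then a * y u + (1 - a) * y v else 0).
  case: ifP => [/hom -> //|_]; case: ifP => // _; exact: ltW.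
apply: (index_lt z0 zE (y := y)) => [u|u|]; first exact: x0.
  by rewrite AE /Aop [leLHS]big_mkcond [leRHS]big_mkcond; apply: ler_sum => v _.
exists u1; rewrite AE /Aop [ltLHS]big_mkcond [ltRHS]big_mkcond /=.
rewrite (bigD1 v1) //= [ltRHS](bigD1 v1) //= uv1 (negbTE nuv1).
by apply: ltr_leD; [exact: term | apply: ler_sum => v _].
Qed.

(** * Loads in an arbitrary graph *)

Section PerronBranches.
Variables (R : realType) (a l : R) (G : sgraph) (x : G -> R).
Hypotheses (a01 : 0 <= a < 1) (x_gt0 : forall u, 0 < x u)
  (xE : forall u, Aop a x u = l * x u).

Let b_gt0 : 0 < 1 - a. Proof. by rewrite subr_gt0; case/andP: a01. Qed.

(* [flow u w] is the part of [l * x u] contributed by the neighbour [w]. *)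
Definition flow (u w : G) : R := a * x u + (1 - a) * x w.

Lemma flow_gt0 u w : 0 < flow u w.
Proof.
have /andP[a0 _] := a01.
by rewrite /flow ltr_wpDl ?mulr_ge0 ?mulr_gt0 // ltW.
Qed.

Lemma flow_sum_le u (s : seq G) (W : {set G}) :
    uniq s -> all (adj u) s -> (forall w, w \in W -> adj u w /\ w \notin s) ->
  \sum_(w in W) flow u w + \sum_(w <- s) flow u w <= l * x u.
Proof.
move=> us /allP adjs adjW; rewrite -xE /Aop.
rewrite big_uniq //= -bigU /=; last first.
  by rewrite disjoint_subset; apply/subsetP => w /adjW[_]; rewrite inE.
rewrite [leLHS]big_mkcond [leRHS]big_mkcond; apply: ler_sum => w _.
case: ifP => [|_]; last by case: ifP => // _; exact/ltW/flow_gt0.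
by rewrite inE => /orP[/adjW[-> _]|/adjs ->].
Qed.

Lemma branch_flow u p v : v * x u + flow u p <= l * x u ->
  v < l - a /\ branch a (1 - a) l v * x p <= flow p u.
Proof.
have bx w : 0 < (1 - a) * x w by rewrite mulr_gt0.
rewrite /flow => H.
have H1 : (1 - a) * x p <= (l - a - v) * x u.
  have -> : (l - a - v) * x u = l * x u - a * x u - v * x u by ring.
  lra.
have v0 : 0 < l - a - v.
  by rewrite -(pmulr_lgt0 _ (x_gt0 u)); apply: lt_le_trans H1.
split; first by rewrite -subr_gt0.
rewrite /branch mulrDl lerD2l mulrAC ler_pdivrMr // expr2 -!mulrA.
by rewrite ler_pM2l // [leRHS]mulrC.
Qed.

Lemma alpha_lt_index (u w : G) : adj u w -> a < l.
Proof.
move=> uw; rewrite -subr_gt0.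
have [|//] := @branch_flow u w 0.
have := @flow_sum_le u [:: w] set0 isT; rewrite /= uw big_set0 big_seq1 mul0r.
by apply=> // ?; rewrite inE.
Qed.

Lemma leaf_flow u w : adj u w -> pend a (1 - a) l * x u <= flow u w.
Proof.
move=> uw; have [] // := @branch_flow w u 0.
have := @flow_sum_le w [:: u] set0 isT.
rewrite /= adj_sym uw big_set0 big_seq1 mul0r.
by apply=> // ?; rewrite inE.
Qed.

Lemma pendants_flow_le u (s : seq G) (W : {set G}) :
    uniq s -> all (adj u) s -> (forall w, w \in W -> adj u w /\ w \notin s) ->
  #|W|%:R * pend a (1 - a) l * x u + \sum_(w <- s) flow u w <= l * x u.
Proof.
move=> us adjs adjW; apply: le_trans (flow_sum_le us adjs adjW).
rewrite lerD2r -mulrA mulr_natl -sumr_const; apply: ler_sum => w /adjW[uw _].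
exact: leaf_flow.
Qed.

Definition attached (C : seq G) (c1 c2 c3 : G) (f : G -> G) : Prop :=
  forall w, w \notin C -> f w \in [:: c1; c2; c3] /\ adj (f w) w.

Definition pendants (C : seq G) (f : G -> G) (c : G) : {set G} :=
  [set w | (w \notin C) && (f w == c)].

Lemma card_pendants C c1 c2 c3 f : uniq C -> uniq [:: c1; c2; c3] ->
    attached C c1 c2 c3 f ->
  (#|pendants C f c1| + #|pendants C f c2| + #|pendants C f c3| + size C
   = #|G|)%N.
Proof.
rewrite /= !inE negb_or andbT => uC /andP[/andP[c12 c13] c23] att.
have cC : #|[set w in C]| = size C by rewrite cardsE; apply/card_uniqP.
rewrite -(cardsC [set w in C]) cC addnC; congr (_ + _)%N.
have -> : ~: [set w in C] =
    pendants C f c1 :|: (pendants C f c2 :|: pendants C f c3).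
  apply/setP => w; rewrite !inE -!andb_orr.
  case: (boolP (w \in C)) => //= wC.
  by have [] := att w wC; rewrite !inE => ->.
rewrite !cardsU.
have -> : pendants C f c2 :&: pendants C f c3 = set0.
  apply/setP => w; rewrite !inE; apply/negbTE/negP.
  by case/andP=> /andP[_ /eqP->] /andP[_ /eqP E]; rewrite E eqxx in c23.
have -> : pendants C f c1 :&: (pendants C f c2 :|: pendants C f c3) = set0.
  apply/setP => w; rewrite !inE; apply/negbTE/negP.
  case/andP=> /andP[_ /eqP->] /orP[] /andP[_ /eqP E].
    by rewrite E eqxx in c12.
  by rewrite E eqxx in c13.
by rewrite cards0 !subn0 addnA.
Qed.

Lemma attached_flow_le C c1 c2 c3 f c (s : seq G) : attached C c1 c2 c3 f ->
    uniq s -> all (adj c) s -> {subset s <= C} ->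
  #|pendants C f c|%:R * pend a (1 - a) l * x c + \sum_(w <- s) flow c w
    <= l * x c.
Proof.
move=> att us adjs sC; apply: pendants_flow_le => // w.
rewrite inE => /andP[wC /eqP <-]; split; first by have [] := att w wC.
by apply: contraNN wC => /sC.
Qed.

Lemma end_flow C c1 c2 c3 f c p : attached C c1 c2 c3 f -> adj c p -> p \in C ->
  let v := #|pendants C f c|%:R * pend a (1 - a) l in
  v < l - a /\ branch a (1 - a) l v * x p <= flow p c.
Proof.
move=> att cp pC; apply: branch_flow.
have := @attached_flow_le C c1 c2 c3 f c [:: p] att isT.
rewrite /= cp big_seq1; apply=> // w.
by rewrite inE => /eqP->.
Qed.

Lemma mid_flow z u w v : adj z u -> adj z w -> u != w ->
    v * x z <= flow z u ->
  v < l - a /\ branch a (1 - a) l v * x w <= flow w z.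
Proof.
move=> zu zw uw vz; apply: branch_flow.
have := @flow_sum_le z [:: u; w] set0; rewrite /= inE andbT uw zu zw.
rewrite big_set0 add0r big_cons big_seq1 => /(_ isT isT) H.
apply: le_trans (H _) => [|t]; last by rewrite inE.
by rewrite lerD2r.
Qed.

Lemma center_flow C c1 c2 c3 f c p p' : attached C c1 c2 c3 f ->
    adj c p -> adj c p' -> p != p' -> p \in C -> p' \in C ->
  #|pendants C f c|%:R * pend a (1 - a) l * x c + (flow c p + flow c p')
    <= l * x c.
Proof.
move=> att cp cp' pp' pC p'C.
have := @attached_flow_le C c1 c2 c3 f c [:: p; p'] att.
rewrite /= inE andbT pp' cp cp' big_cons big_seq1; apply=> // w.
by rewrite !inE => /orP[] /eqP->.
Qed.

Lemma path_case v1 v4 v2 v5 v3 f (C := [:: v1; v4; v2; v5; v3]) : uniq C ->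
    adj v1 v4 -> adj v4 v2 -> adj v2 v5 -> adj v5 v3 ->
    attached C v1 v2 v3 f ->
  H3_good a (1 - a) l #|pendants C f v1| #|pendants C f v2| #|pendants C f v3|.
Proof.
move=> uC e14 e42 e25 e53 att; have /andP[a0 _] := a01.
have al := alpha_lt_index e14.
have [v4C v5C] : v4 \in C /\ v5 \in C by rewrite !inE !eqxx !orbT.
have [n12 n23 n45] : [/\ v1 != v2, v3 != v2 & v4 != v5].
  move: uC; rewrite /= !inE !negb_or => /and5P[].
  move=> /and4P[_ -> _ _] /and3P[_ -> _] /andP[_ n23] _.
  by rewrite (eq_sym _ v2) n23.
have [e41 e24 e35] : [/\ adj v4 v1, adj v2 v4 & adj v3 v5].
  by split; rewrite adj_sym.
have [s1 h1] := end_flow att e14 v4C.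
have [s2 h2] := mid_flow e41 e42 n12 h1.
have [k1 g1] := end_flow att e35 v5C.
have [|k2 g2] := mid_flow e53 _ n23 g1; first by rewrite adj_sym.
have c2 := center_flow att e24 e25 n45 v4C v5C.
apply: H3_goodP => //; rewrite -(ler_pM2r (x_gt0 v2)).
lra.
Qed.

Lemma claw_case u1 u2 u3 z f (C := [:: u1; u2; u3; z]) : uniq C ->
    adj z u1 -> adj z u2 -> adj z u3 ->
    attached C u1 u2 u3 f -> (9 <= #|G|)%N ->
  exists s t k, (s + t + k + 5 = #|G|)%N /\ H3_sgood a (1 - a) l s t k.
Proof.
move=> uC e1 e2 e3 att n9; have /andP[a0 _] := a01.
have al := alpha_lt_index e1.
have zC : z \in C by rewrite !inE eqxx !orbT.
have uc : uniq [:: u1; u2; u3].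
  move: uC; rewrite (_ : C = rcons [:: u1; u2; u3] z) //.
  by rewrite rcons_uniq => /andP[].
have := card_pendants uC uc att; rewrite (_ : size C = 4%N) //.
have [|s1 h1] := end_flow att _ zC (c := u1); first by rewrite adj_sym.
have [|s2 h2] := end_flow att _ zC (c := u2); first by rewrite adj_sym.
have [|s3 h3] := end_flow att _ zC (c := u3); first by rewrite adj_sym.
move: s1 s2 s3 h1 h2 h3.
move: #|pendants C f u1| #|pendants C f u2| #|pendants C f u3| => s t k.
move=> sl tl kl h1 h2 h3 sum.
have H : branch a (1 - a) l (s%:R * pend a (1 - a) l)
    + branch a (1 - a) l (t%:R * pend a (1 - a) l)
    + branch a (1 - a) l (k%:R * pend a (1 - a) l) <= l.
  rewrite -(ler_pM2r (x_gt0 z)).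
  have := @flow_sum_le z [:: u1; u2; u3] set0 uc.
  rewrite /= e1 e2 e3 big_set0 add0r !big_cons big_nil addr0 => /(_ isT) H.
  apply: le_trans (H _) => [|w]; last by rewrite inE.
  lra.
have claw := @H3_sgood_of_claw _ a (1 - a) l a0 b_gt0 al.
have [|[]] : (t <= s /\ t <= k \/ (s <= t /\ s <= k \/ k <= s /\ k <= t))%N.
- by move: s t k {sl tl kl h1 h2 h3 H sum}; clear; lia.
- move=> [ts tk]; have [|s' [t' [k' [E g]]]] := claw s t k ts tk _ sl tl kl H.
    by move: sum n9; clear; lia.
  by exists s', t', k'; split=> //; move: sum E n9; clear; lia.
- move=> [st sk]; have [||s' [t' [k' [E g]]]] := claw t s k st sk _ tl sl kl.
  + by move: sum n9; clear; lia.
  + by rewrite [X in X + _]addrC.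
  by exists s', t', k'; split=> //; move: sum E n9; clear; lia.
move=> [ks kt]; have [||s' [t' [k' [E g]]]] := claw s k t ks kt _ sl kl tl.
+ by move: sum n9; clear; lia.
+ by rewrite addrAC.
by exists s', t', k'; split=> //; move: sum E n9; clear; lia.
Qed.

Lemma edge_cherry_case u1 u2 u3 z z' f (C := [:: u1; u2; u3; z]) : uniq C ->
    adj u1 u2 -> adj u2 z -> adj z u3 ->
    attached C u1 u2 u3 f -> z' \notin C -> f z' = u1 -> (9 <= #|G|)%N ->
  exists s t k, (s + t + k + 5 = #|G|)%N /\ H3_sgood a (1 - a) l s t k.
Proof.
move=> uC e12 e2z ez3 att z'C fz' n9; have /andP[a0 _] := a01.
have al := alpha_lt_index e12.
have [u1C u2C zC] : [/\ u1 \in C, u2 \in C & z \in C].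
  by rewrite !inE !eqxx !orbT.
have uc : uniq [:: u1; u2; u3].
  move: uC; rewrite (_ : C = rcons [:: u1; u2; u3] z) //.
  by rewrite rcons_uniq => /andP[].
have [n1z n32] : u1 != z /\ u3 != u2.
  move: uC; rewrite /= !inE !negb_or => /and4P[/and3P[_ _ ->] /andP[n23 _] _ _].
  by rewrite eq_sym n23.
have := card_pendants uC uc att; rewrite (_ : size C = 4%N) //.
have [s1 h1] := end_flow att e12 u2C.
have [|k1 g1] := end_flow att _ zC (c := u3); first by rewrite adj_sym.
have [|k2 g2] := mid_flow ez3 _ n32 g1; first by rewrite adj_sym.
have := @center_flow C u1 u2 u3 f u2 u1 z att _ e2z n1z u1C zC.
move=> /(_ ltac:(by rewrite adj_sym)).
have : (0 < #|pendants C f u1|)%N.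
  by apply/card_gt0P; exists z'; rewrite inE z'C fz' eqxx.
move: s1 k1 k2 h1 g1 g2.
move: #|pendants C f u1| #|pendants C f u2| #|pendants C f u3| => s t k.
move=> sl kl kl2 h1 g1 g2 s0 c2 sum.
have [||s' [t' [k' [E g]]]] :=
  @H3_sgood_of_edge_cherry _ a (1 - a) l a0 b_gt0 al s t k s0 _ sl kl kl2.
- by move: sum n9; clear; lia.
- rewrite -(ler_pM2r (x_gt0 u2)); lra.
by exists s', t', k'; split=> //; move: sum E n9; clear; lia.
Qed.

Lemma edge_edge_case u1 u2 u3 z z' f (C := [:: u1; u2; u3]) : uniq C ->
    adj u1 u2 -> adj u2 u3 -> attached C u1 u2 u3 f ->
    z \notin C -> f z = u1 -> z' \notin C -> f z' = u3 -> (9 <= #|G|)%N ->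
  exists s t k, (s + t + k + 5 = #|G|)%N /\ H3_sgood a (1 - a) l s t k.
Proof.
move=> uC e12 e23 att zC fz z'C fz' n9; have /andP[a0 _] := a01.
have al := alpha_lt_index e12.
have [u1C u2C u3C] : [/\ u1 \in C, u2 \in C & u3 \in C].
  by rewrite !inE !eqxx !orbT.
have n13 : u1 != u3.
  by move: uC; rewrite /= !inE !negb_or => /and3P[/andP[_ ->]].
have := card_pendants uC uC att; rewrite (_ : size C = 3%N) //.
have [s1 h1] := end_flow att e12 u2C.
have [|k1 g1] := end_flow att _ u2C (c := u3); first by rewrite adj_sym.
have c2 := @center_flow C u1 u2 u3 f u2 u1 u3 att _ e23 n13 u1C u3C.
have {}c2 := c2 ltac:(by rewrite adj_sym).
have : (0 < #|pendants C f u1|)%N.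
  by apply/card_gt0P; exists z; rewrite inE zC fz eqxx.
have : (0 < #|pendants C f u3|)%N.
  by apply/card_gt0P; exists z'; rewrite inE z'C fz' eqxx.
move: s1 k1 h1 g1 c2.
move: #|pendants C f u1| #|pendants C f u2| #|pendants C f u3| => s t k.
move=> sl kl h1 g1 c2 k0 s0 sum.
have [||s' [t' [k' [E g]]]] :=
  @H3_sgood_of_edge_edge _ a (1 - a) l a0 b_gt0 al s t k s0 k0 _ sl kl.
- by move: sum n9; clear; lia.
- rewrite -(ler_pM2r (x_gt0 u2)); lra.
by exists s', t', k'; split=> //; move: sum E n9; clear; lia.
Qed.
End PerronBranches.

Lemma H3_embedding (G : sgraph) (v1 v4 v2 v5 v3 : G) f
    (C := [:: v1; v4; v2; v5; v3]) : uniq C ->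
    adj v1 v4 -> adj v4 v2 -> adj v2 v5 -> adj v5 v3 ->
    attached C v1 v2 v3 f ->
  exists2 phi : H3 #|pendants C f v1| #|pendants C f v2| #|pendants C f v3| -> G,
    bijective phi & forall u v, adj u v -> adj (phi u) (phi v).
Proof.
move=> uC e14 e42 e25 e53 att.
have uc : uniq [:: v1; v2; v3].
  apply: subseq_uniq uC; apply/subseqP.
  by exists [:: true; false; true; false; true].
have [n12 n13 n23] : [/\ v1 <> v2, v1 <> v3 & v2 <> v3].
  move: uc; rewrite /= !inE negb_or andbT.
  by case/andP=> /andP[/eqP ? /eqP ?] /eqP ?.
pose phi (u : H3 #|pendants C f v1| #|pendants C f v2| #|pendants C f v3|) : G :=
  match u : H3_vertex _ _ _ with
  | inl i => nth v1 C i
  | inr (inl (inl i)) => enum_val i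
  | inr (inl (inr i)) => enum_val i
  | inr (inr i) => enum_val i end.
have pend (c : G) (i : 'I_#|pendants C f c|) :
    [/\ enum_val i \notin C, f (enum_val i) = c & adj c (enum_val i)].
  have := enum_valP i; rewrite inE => /andP[iC /eqP fi]; split=> //.
  by have [] := att _ iC; rewrite fi.
have core (i : 'I_5) : nth v1 C i \in C by rewrite mem_nth.
exists phi.
  apply: inj_card_bij; last first.
    by rewrite card_H3 -(card_pendants uC uc att) addnC.
  have coreN c (i : 'I_5) (j : 'I_#|pendants C f c|) : nth v1 C i <> enum_val j.
    by move=> E; have [+ _ _] := pend _ j; rewrite -E core.
  have pendN c c' (i : 'I_#|pendants C f c|) (j : 'I_#|pendants C f c'|) :
      c <> c' -> enum_val i <> enum_val j.
    move=> cc' E; apply: cc'; have [_ fi _] := pend _ i.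
    by have [_ fj _] := pend _ j; rewrite -fi E.
  move=> [i|[[i|i]|i]] [j|[[j|j]|j]] /= E.
  - by congr inl; apply/val_inj/eqP; move/eqP: E; rewrite nth_uniq.
  - by have := coreN _ _ _ E.
  - by have := coreN _ _ _ E.
  - by have := coreN _ _ _ E.
  - by have := coreN _ _ _ (esym E).
  - by congr (inr (inl (inl _))); apply: enum_val_inj.
  - by have := pendN _ _ _ _ n12 E.
  - by have := pendN _ _ _ _ n13 E.
  - by have := coreN _ _ _ (esym E).
  - by have := pendN _ _ _ _ n12 (esym E).
  - by congr (inr (inl (inr _))); apply: enum_val_inj.
  - by have := pendN _ _ _ _ n23 E.
  - by have := coreN _ _ _ (esym E).
  - by have := pendN _ _ _ _ n13 (esym E).
  - by have := pendN _ _ _ _ n23 (esym E).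
  - by congr (inr (inr _)); apply: enum_val_inj.
have arc u v : H3_arc u v -> adj (phi u) (phi v).
  case: u => [[[|[|[|[|[|//]]]]] lti]|[[i|i]|i]];
  case: v => [[[|[|[|[|[|//]]]]] ltj]|[[j|j]|j]] //= _;
  by have [_ _ ->] := pend _ j.
by move=> u v /orP[/arc //|/arc]; rewrite adj_sym.
Qed.

(** * Covers of size three *)

Inductive cover_config (G : sgraph) : Prop :=
| PathConfig (v1 v4 v2 v5 v3 : G) (f : G -> G) of uniq [:: v1; v4; v2; v5; v3]
    & adj v1 v4 & adj v4 v2 & adj v2 v5 & adj v5 v3
    & attached [:: v1; v4; v2; v5; v3] v1 v2 v3 f
| ClawConfig (u1 u2 u3 z : G) (f : G -> G) of uniq [:: u1; u2; u3; z]
    & adj z u1 & adj z u2 & adj z u3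
    & attached [:: u1; u2; u3; z] u1 u2 u3 f
| EdgeCherryConfig (u1 u2 u3 z z' : G) (f : G -> G) of uniq [:: u1; u2; u3; z]
    & adj u1 u2 & adj u2 z & adj z u3
    & attached [:: u1; u2; u3; z] u1 u2 u3 f
    & z' \notin [:: u1; u2; u3; z] & f z' = u1
| EdgeEdgeConfig (u1 u2 u3 z z' : G) (f : G -> G) of uniq [:: u1; u2; u3]
    & adj u1 u2 & adj u2 u3 & attached [:: u1; u2; u3] u1 u2 u3 f
    & z \notin [:: u1; u2; u3] & f z = u1
    & z' \notin [:: u1; u2; u3] & f z' = u3.

Section Cover.
Variables (G : sgraph) (S : {set G}).
Hypotheses (conG : connected_graph G) (indS : independent S)
  (domS : forall u, u \notin S -> exists2 z, z \in S & adj u z).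

Let adjS z z' : z \in S -> z' \in S -> adj z z' = false.
Proof.
move=> zS z'S; apply/negbTE; move/forall_inP: indS => /(_ z zS).
by move/forall_inP; apply.
Qed.

Definition linked (u w : G) : bool :=
  adj u w || [exists z in S, adj u z && adj z w].

Lemma linkedC : symmetric linked.
Proof.
move=> u w; rewrite /linked adj_sym; congr (_ || _).
apply: eq_existsb => z.
by rewrite (adj_sym u z) (adj_sym z w) (andbC (adj z u)).
Qed.

Lemma linked_crossing (A : {set G}) u0 w0 : [disjoint A & S] -> u0 \in A ->
    w0 \notin A -> w0 \notin S ->
  exists u w, [/\ u \in A, w \notin A, w \notin S & linked u w].
Proof.
move=> dAS u0A w0A w0S.
have [/existsP[u /existsP[w /and4P[]]]|] := boolP [exists u, [exists w,
    [&& u \in A, w \notin A, w \notin S & linked u w]]]; first by exists u, w.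
move=> nolink; exfalso.
have nl u w : u \in A -> w \notin A -> w \notin S -> linked u w = false.
  move=> uA wA wS; apply/negbTE; apply: contraNN nolink => l.
  by apply/existsP; exists u; apply/existsP; exists w; rewrite uA wA wS.
pose B := A :|: [set z in S | [exists u in A, adj u z]].
have closedB : closed (@adj G) (mem B).
  apply: intro_closed; first by apply: sym_connect_sym; exact: adj_sym.
  move=> x y xy; rewrite !inE => /orP[xA|/andP[xS /exists_inP[u uA ux]]].
    have [yA|yA] //= := boolP (y \in A).
    have [yS|yS] /= := boolP (y \in S); first by apply/exists_inP; exists x.
    by have := nl _ _ xA yA yS; rewrite /linked xy.
  have yS : y \notin S by apply: contraL xy => yS; rewrite adjS.
  have [//|yA] := boolP (y \in A).
  have /negP := negbT (nl _ _ uA yA yS); case; apply/orP; right.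
  by apply/exists_inP; exists x => //; rewrite ux.
have := closed_connect closedB (conG u0 w0).
by rewrite !inE u0A (negbTE w0A) (negbTE w0S).
Qed.

Lemma linked_middle : #|~: S| = 3%N -> exists c1 c2 c3,
  [/\ ~: S = [set c1; c2; c3], uniq [:: c1; c2; c3], linked c1 c2 & linked c2 c3].
Proof.
move=> c3.
have /card_gt0P[u] : (0 < #|~: S|)%N by rewrite c3.
rewrite inE => uS.
have c2 : (1 < #|~: S|)%N by rewrite c3.
have [w0] : exists w0, (w0 \in ~: S) && (w0 != u).
  apply/existsP; apply: contraLR c2 => /existsPn H; rewrite -leqNgt.
  apply: (@leq_trans #|[set u]|); last by rewrite cards1.
  apply: subset_leq_card; apply/subsetP => w wS; rewrite inE.
  by have := H w; rewrite wS /= negbK.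
rewrite inE => /andP[w0S w0u].
have dis1 (A : {set G}) : A \subset ~: S -> [disjoint A & S].
  by move=> AS; rewrite disjoints_subset.
have [||||u1 [w [+ wu wS uw]]] := @linked_crossing [set u] u w0.
- by apply: dis1; rewrite sub1set inE.
- by rewrite inE.
- by rewrite inE.
- by [].
rewrite !inE => /eqP E; subst u1; rewrite inE in wu.
have cuw : #|[set u; w]| = 2%N by rewrite cards2 eq_sym wu.
have suw : [set u; w] \subset ~: S.
  by apply/subsetP => x; rewrite !inE => /orP[] /eqP->.
have [t0] : exists t0, (t0 \in ~: S) && (t0 \notin [set u; w]).
  apply/existsP; apply: contra_eqT c3 => /existsPn H.
  rewrite neq_ltn; apply/orP; left; apply: (@leq_ltn_trans #|[set u; w]|).
    apply: subset_leq_card; apply/subsetP => x xS.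
    by have := H x; rewrite xS /= negbK.
  by rewrite cuw.
rewrite inE => /andP[t0S t0uw].
have [||||m [t [+ tuw tS mt]]] := @linked_crossing [set u; w] u t0.
- exact: dis1.
- by rewrite !inE eqxx.
- by [].
- by [].
have cover : ~: S = [set u; w; t].
  apply/esym/eqP; rewrite eqEcard c3 setUC cardsU1 cuw tuw /= andbT.
  apply/subsetP => x; rewrite !inE => /orP[/eqP->//|/orP[]/eqP->//].
move: tuw; rewrite !inE negb_or => /andP[tu tw] /orP[] /eqP E; subst m.
  exists w, u, t; split=> //; last by rewrite linkedC.
    by rewrite cover (setUC [set u]).
  by rewrite /= !inE negb_or wu (eq_sym w) tw (eq_sym u) tu.
exists u, w, t; split=> //.
by rewrite /= !inE negb_or (eq_sym u) wu (eq_sym u) tu (eq_sym w) tw.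
Qed.

Let parent (w : G) : G := odflt w [pick u | (u \notin S) && adj u w].

Let parentP w c : c \notin S -> w \in S -> parent w \notin S /\ adj (parent w) w.
Proof.
move=> cS wS; rewrite /parent; case: pickP => [u /andP[] //|noparent].
have /connectP[[|x p] /=] := conG w c.
  by move=> _ E; rewrite E wS in cS.
move=> /andP[wx _] _; have := noparent x; rewrite adj_sym wx andbT.
by move/negbFE => xS; rewrite adjS in wx.
Qed.

Let covers (c1 c2 c3 : G) := forall w, (w \notin S) = (w \in [:: c1; c2; c3]).

Let attached_parent (C : seq G) c1 c2 c3 : covers c1 c2 c3 ->
  {subset [:: c1; c2; c3] <= C} -> attached C c1 c2 c3 parent.
Proof.
move=> cov sC w wC; have wS : w \in S.
  by rewrite -[_ \in _]negbK cov; apply: contraNN wC => /sC.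
have c1S : c1 \notin S by rewrite cov inE eqxx.
by have [] := parentP c1S wS; rewrite cov.
Qed.

Let attached_upd C c1 c2 c3 (f : G -> G) z u : attached C c1 c2 c3 f ->
    u \in [:: c1; c2; c3] -> adj u z ->
  attached C c1 c2 c3 (fun w : G => if w == z then u else f w).
Proof. by move=> att uc uz w wC; case: eqP => [->|_] //; apply: att. Qed.

Let edge_cherry_config c1 c2 c3 z : covers c1 c2 c3 -> uniq [:: c1; c2; c3] ->
  z \in S -> adj c1 c2 -> adj c2 z -> adj z c3 -> cover_config G.
Proof.
move=> cov uc zS e12 e2z ez3.
have c1S : c1 \notin S by rewrite cov inE eqxx.
have zc : z \notin [:: c1; c2; c3] by rewrite -cov zS.
have uC : uniq [:: c1; c2; c3; z].
  by rewrite (_ : [:: c1; c2; c3; z] = rcons [:: c1; c2; c3] z) // rcons_uniq zc.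
have sC : {subset [:: c1; c2; c3] <= [:: c1; c2; c3; z]}.
  by move=> w; rewrite !inE => /or3P[] ->; rewrite ?orbT.
have att := attached_parent cov sC.
have [z' z'S e1z'] := domS c1S.
have [zz'|zz'] := eqVneq z' z.
  by apply: (ClawConfig uC _ _ ez3 att); rewrite adj_sym // -zz'.
apply: (EdgeCherryConfig uC e12 e2z ez3 (attached_upd att _ e1z') (z' := z')).
- by rewrite inE eqxx.
- move: z'S; rewrite -[z' \in S]negbK cov !inE !negb_or => /and3P[-> -> ->].
  by rewrite zz'.
- by rewrite eqxx.
Qed.

Lemma cover_configP : #|~: S| = 3%N -> cover_config G.
Proof.
move=> card3; have [c1 [c2 [c3 [SE uc l12 l23]]]] := linked_middle card3.
have cov : covers c1 c2 c3 by move=> w; rewrite -in_setC SE !inE orbA.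
have cov321 : covers c3 c2 c1.
  by move=> w; rewrite cov !inE orbC orbA (orbC (w == c2)) -orbA orbCA.
have cov213 : covers c2 c1 c3 by move=> w; rewrite cov !inE orbCA.
have uc321 : uniq [:: c3; c2; c1].
  by rewrite (_ : [:: c3; c2; c1] = rev [:: c1; c2; c3]) // rev_uniq.
have uc213 : uniq [:: c2; c1; c3].
  move: uc; rewrite /= !inE !negb_or !andbT (eq_sym c2 c1).
  by case/andP=> /andP[-> ->] ->.
have [c1S c3S] : c1 \notin S /\ c3 \notin S by rewrite !cov !inE !eqxx !orbT.
have outer z : z \in S -> z \notin [:: c1; c2; c3] by rewrite -cov => ->.
case/orP: l12 => [e12|/exists_inP[z zS /andP[e1z ez2]]].
  case/orP: l23 => [e23|/exists_inP[z' z'S /andP[e2z ez3]]].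
    have [z zS e1z] := domS c1S; have [z' z'S e3z'] := domS c3S.
    have [zz'|zz'] := eqVneq z z'.
      subst z'; apply: (edge_cherry_config cov213 uc213 zS _ e1z).
        by rewrite adj_sym.
      by rewrite adj_sym.
    have att := attached_parent cov (fun w wc => wc).
    have att' := attached_upd (attached_upd att _ e1z) _ e3z'.
    apply: (EdgeEdgeConfig uc e12 e23 (att' _ _) (outer z zS) _ (outer z' z'S) _).
    - by rewrite inE eqxx.
    - by rewrite !inE eqxx !orbT.
    - by rewrite /= (negbTE zz') eqxx.
    - by rewrite eqxx.
  exact: (edge_cherry_config cov uc z'S e12 e2z ez3).
case/orP: l23 => [e23|/exists_inP[z' z'S /andP[e2z' ez'3]]].
  by apply: (edge_cherry_config cov321 uc321 zS); rewrite adj_sym.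
have [zz'|zz'] := eqVneq z z'.
  subst z'.
  have uC : uniq [:: c1; c2; c3; z].
    rewrite (_ : [:: c1; c2; c3; z] = rcons [:: c1; c2; c3] z) //.
    by rewrite rcons_uniq outer.
  apply: (ClawConfig uC _ ez2 ez'3); first by rewrite adj_sym.
  apply: attached_parent cov _.
  by move=> w; rewrite !inE => /or3P[] ->; rewrite ?orbT.
have uC : uniq [:: c1; z; c2; z'; c3].
  move: uc (outer z zS) (outer z' z'S).
  rewrite /= !inE !negb_or zz' !andbT (eq_sym c1 z) (eq_sym c1 z') (eq_sym c2 z').
  by case/andP=> /andP[-> ->] -> /and3P[-> -> ->] /and3P[-> -> ->].
apply: (PathConfig uC e1z ez2 e2z' ez'3).
apply: attached_parent cov _.
by move=> w; rewrite !inE => /or3P[] ->; rewrite ?orbT.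
Qed.
End Cover.

Lemma in_class_H3 n s t k : (9 <= n)%N -> (s + t + k + 5 = n)%N ->
  in_class n (n - 3) (H3 s t k).
Proof.
move=> n9 sum; split; first exact: connected_H3.
  by rewrite card_H3; lia.
by rewrite independence_number_H3; lia.
Qed.

Lemma independence_number_attained (G : sgraph) :
  exists2 S : {set G}, independent S & #|S| = independence_number G.
Proof.
have [|S indS E] := @eq_bigmax_cond _ [pred S : {set G} | independent S]
    (fun S => #|S|); last by exists S.
by apply/card_gt0P; exists set0; rewrite inE; apply/forall_inP => x; rewrite inE.
Qed.

Lemma maximum_independent_dominates (G : sgraph) (S : {set G}) :
    independent S -> #|S| = independence_number G ->
  forall u, u \notin S -> exists2 z, z \in S & adj u z.
Proof.
move=> indS cS u uS; apply/exists_inP; apply: contraT => /exists_inPn nou.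
have : independent (u |: S).
  apply/forall_inP => x; rewrite !inE => xS; apply/forall_inP => y.
  rewrite !inE => yS; case/orP: xS => [/eqP->|xS].
    case/orP: yS => [/eqP->|yS]; [by rewrite adj_irrefl | exact: nou].
  case/orP: yS => [/eqP->|yS]; first by rewrite adj_sym nou.
  by move/forall_inP: indS => /(_ x xS)/forall_inP; apply.
move/(@leq_bigmax_cond _ (@independent G) (fun S => #|S|)).
by rewrite -/(independence_number G) -cS cardsU1 uS ltnn.
Qed.

Theorem theorem1p3 (R : realType) (n : nat) (alpha : R) (G : sgraph)
  (hn : (9 <= n)%N) (halpha : 0 <= alpha < 1)
  (hG : min_Aalpha_index alpha n (n - 3)%N G) :
  [/\ exists s t k : nat,
        [/\ `|s%:Z - k%:Z| <= 1, (s + t + k = n - 5)%N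
          & isomorphic G (H3 s t k)],
      forall m : nat, 1 / 2 <= alpha -> n = (3 * m)%N ->
        isomorphic G (H3 (m - 1) (m - 3) (m - 1)),
      forall m : nat, 1 / 2 <= alpha -> n = (3 * m + 1)%N ->
        isomorphic G (H3 (m - 1) (m - 2) (m - 1))
    & forall m : nat, 11 / 20 <= alpha -> n = (3 * m + 2)%N ->
        isomorphic G (H3 m (m - 3) m)].
Proof.
have [[conG cG aG] [l idxG minG]] := hG; have [a0 a1] := andP halpha.
have b0 : 0 < 1 - alpha by rewrite subr_gt0.
have [u0 _] : exists u0 : G, u0 \in G by apply/card_gt0P; rewrite cG; lia.
have [l' [idxG' [x x0 xE]]] := perron u0 halpha conG.
have El : l' = l.
  by apply/eqP; rewrite eq_le; case: idxG idxG' => e m [e' m'];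
     rewrite m' // m.
subst l'.
have no_better s t k : (s + t + k + 5 = n)%N ->
    H3_sgood alpha (1 - alpha) l s t k -> False.
  move=> sum /(H3_index_lt halpha)[mu idx mul].
  by have := minG _ _ (in_class_H3 hn sum) idx; rewrite leNgt mul.
have no_config : ~ (exists s t k, (s + t + k + 5 = #|G|)%N /\
    H3_sgood alpha (1 - alpha) l s t k).
  by case=> s [t [k []]]; rewrite cG; apply: no_better.
have n9 : (9 <= #|G|)%N by rewrite cG.
have [S indS cS] := independence_number_attained G.
have card3 : #|~: S| = 3%N by have := cardsC S; rewrite cS aG cG; lia.
have domS := maximum_independent_dominates indS cS.
have al : alpha < l.
  have [u uS] : exists u, u \in ~: S by apply/card_gt0P; rewrite card3.
  rewrite inE in uS; have [z _ uz] := domS u uS.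
  exact: (alpha_lt_index halpha x0 xE uz).
case: (cover_configP conG indS domS card3) => [v1 v4 v2 v5 v3 f uC e14 e42 e25
  e53 att|u1 u2 u3 z f uC e1 e2 e3 att|u1 u2 u3 z z' f uC e1 e2 e3 att zC fz
  |u1 u2 u3 z z' f uC e1 e2 att zC fz zC' fz']; last first.
- by case: no_config; apply: edge_edge_case att zC fz zC' fz' n9.
- by case: no_config; apply: edge_cherry_case att zC fz n9.
- by case: no_config; apply: claw_case att n9.
have gd := path_case halpha x0 xE uC e14 e42 e25 e53 att.
have [phi bphi hom] := H3_embedding uC e14 e42 e25 e53 att.
have uc : uniq [:: v1; v2; v3].
  apply: subseq_uniq uC; apply/subseqP.
  by exists [:: true; false; true; false; true].
have := card_pendants uC uc att; rewrite cG [size _]/= => sum.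
move: #|pendants _ f v1| #|pendants _ f v2| #|pendants _ f v3| phi bphi hom gd
  sum => s t k phi bphi hom gd sum.
have iso : isomorphic G (H3 s t k).
  have [phiE|[mu idx mul]] := spanning_index_lt (inl ord0 : H3 s t k) halpha
      (@connected_H3 s t k) bphi hom x0 xE; last first.
    by have := minG _ _ (in_class_H3 hn sum) idx; rewrite leNgt mul.
  case: bphi => g gK Kg; exists g; first by exists phi.
  by move=> u v; rewrite -phiE !Kg.
have [ks sk] : (k <= s.+1 /\ s <= k.+1)%N.
  split; rewrite leqNgt; apply/negP => lt.
    apply: (no_better k.-1 t s.+1); first by move: sum lt; clear; lia.
    exact: H3_balance (H3_good_sym gd).
  apply: (no_better s.-1 t k.+1); first by move: sum lt; clear; lia.
  exact: H3_balance gd.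
split.
- exists s, t, k; split=> //; last by move: sum; clear; lia.
  by move: ks sk; clear; lia.
- move=> m am nm.
  have [N mN] : exists N, m = N.+3.
    by exists (m - 3)%N; move: nm hn; clear; lia.
  have ba : 1 - alpha <= alpha by lra.
  have stk : (s + t + k = 3 * N + 4)%N by move: sum nm mN; clear; lia.
  have [[Es Et Ek]|better] := H3_optimal_3m a0 b0 al ba stk gd.
    rewrite Ek -Es in iso.
    have -> : (m - 1 = s)%N by rewrite mN Es subn1.
    by have -> : (m - 3 = t)%N by rewrite mN Et -addn3 addnK.
  by case: (no_better _ _ _ _ better); move: nm mN; clear; lia.
- move=> m am nm.
  have [N mN] : exists N, m = N.+3.
    by exists (m - 3)%N; move: nm hn; clear; lia.
  have ba : 1 - alpha <= alpha by lra.
  have stk : (s + t + k = 3 * N + 5)%N by move: sum nm mN; clear; lia.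
  have [[Es Et Ek]|better] := H3_optimal_3m1 a0 b0 al ba stk gd.
    rewrite Ek -Es in iso.
    have -> : (m - 1 = s)%N by rewrite mN Es subn1.
    by have -> : (m - 2 = t)%N by rewrite mN Et subn2.
  by case: (no_better _ _ _ _ better); move: nm mN; clear; lia.
- move=> m am nm.
  have [N mN] : exists N, m = N.+3.
    by exists (m - 3)%N; move: nm hn; clear; lia.
  have ba : 1 - alpha <= alpha by lra.
  have stk : (s + t + k = 3 * N + 6)%N by move: sum nm mN; clear; lia.
  have [[Es Et Ek]|better] := H3_optimal_3m2 a0 b0 al ba stk gd.
    have -> : (m - 3 = t)%N by rewrite mN Et -addn3 addnK.
    by rewrite mN; rewrite Es Ek in iso.
  by case: (no_better _ _ _ _ better); move: nm mN; clear; lia.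
Qed.
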